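(* Consider the control system with state $(z,\psi,\bar u,r)\in\mathbb{R}^4$ and control inputs $(\bar\tau_1,\tau_2)\in\mathbb{R}^2$ $$\dot z=-\bar u r,\qquad \dot\psi=r,\qquad \dot{\bar u}=\bar\tau_1,\qquad \dot r=\tau_2 .$$ Let $k_1,k_2,k_3,k_4$ be positive constants and let $f:\mathbb{R}\to\mathbb{R}$ be a smooth function satisfying $f(z)=0\Leftrightarrow z=0$. Then under the control law $$\bar\tau_1=k_1 z r-k_2\bar u,\qquad \tau_2=-k_3\psi-k_4 r+f(z)\cos(t),$$ the system is globally uniformly asymptotically stable (GUAS).
   Context: A continuous function $\rho:[0,a)\to[0,\infty)$ is of class $\kappa$ if it is strictly increasing and $\rho(0)=0$. A continuous function $\chi(r,s):[0,a)\times[0,\infty)\to[0,\infty)$ is of class $\kappa\ell$ if for each fixed $s$ the map $r\mapsto\chi(r,s)$ is of class $\kappa$, and for each fixed $r$ the map $s\mapsto\chi(r,s)$ is decreasing with $\chi(r,s)\to0$ as $s\to\infty$. (For global properties, $a=\infty$.) A system $\dot x=f(t,x)$, $f(t,0)=0$ for all $t\ge t_0$ (with $x\in\mathbb{R}^n$, $f$ piecewise continuous in $t$ and locally Lipschitz in $x$) is called globally uniformly asymptotically stable (GUAS) if there exists a class $\kappa\ell$ function $\chi$ such that the trajectory starting from any initial state $x(t_0)\in\mathbb{R}^n$ satisfies $\|x(t)\|\le\chi(\|x(t_0)\|,t-t_0)$ for all $t\ge t_0$. *)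

(* Defs.v *)
(* MathComp-Analysis, over an arbitrary [R : realType]. *)
From HB Require Import structures.
From mathcomp Require Import all_boot all_order all_algebra.
From mathcomp Require Import all_classical all_reals all_analysis.
Set Implicit Arguments.
Unset Strict Implicit.
Unset Printing Implicit Defensive.
Import Order.TTheory GRing.Theory Num.Theory.
Import numFieldNormedType.Exports.
Local Open Scope classical_set_scope.
Local Open Scope ring_scope.

(* The library norm on ['rV[R]_n] is the sup norm. *)
Definition enorm (R : realType) (n : nat) (x : 'rV[R]_n) : R :=
  Num.sqrt (\sum_(i < n) x 0 i ^+ 2).

(* The interval [0, a[, where [a] may be [+oo]. *)
Definition radii (R : realType) (a : \bar R) : set R :=
  [set r | 0 <= r /\ (r%:E < a)%E].

Definition class_kappa (R : realType) (a : \bar R) (rho : R -> R) : Prop :=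
  [/\ {within radii a, continuous rho},
      forall r, radii a r -> 0 <= rho r,
      forall r r', radii a r -> radii a r' -> r < r' -> rho r < rho r'
    & rho 0 = 0].

(* "Decreasing in s" is non-strict: chi 0 is identically 0. *)
Definition class_kl (R : realType) (a : \bar R) (chi : R -> R -> R) : Prop :=
  [/\ {within radii a `*` [set s | 0 <= s],
         continuous (fun p : R * R => chi p.1 p.2)},
      forall s, 0 <= s -> class_kappa a (chi ^~ s),
      forall r, radii a r ->
        forall s s', 0 <= s -> s <= s' -> chi r s' <= chi r s
    & forall r, radii a r -> chi r s @[s --> +oo] --> (0 : R)].

(* On every compact interval, finitely many discontinuities, all of them with
   finite one-sided limits. *)
Definition piecewise_continuous (R : realType) (V : normedModType R)
    (g : R -> V) : Prop :=
  forall a b : R, exists e : seq R, forall t, a <= t <= b ->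
    [/\ t \notin e -> {for t, continuous g},
        cvg (g s @[s --> t^'-]) & cvg (g s @[s --> t^'+])].

(* The Lipschitz constant is uniform for t in compact intervals. *)
Definition locally_lipschitz (R : realType) (n : nat)
    (F : R -> 'rV[R]_n -> 'rV[R]_n) : Prop :=
  forall (a b : R) (x0 : 'rV[R]_n), exists2 U, nbhs x0 U &
    exists k : R, forall t, a <= t <= b -> k.-lipschitz_U (F t).

Definition admissible_system (R : realType) (n : nat)
    (F : R -> 'rV[R]_n -> 'rV[R]_n) : Prop :=
  [/\ forall t, F t 0 = 0,
      forall x, piecewise_continuous (F ^~ x)
    & locally_lipschitz F].

(* Solution on [t0, +oo[ of x' = F(t, x), x(t0) = x0; the values of [x] before
   t0 are irrelevant.  As [F] may jump in t, x is only required to be continuous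
   and to satisfy the equation at those t where F(., x(t)) is continuous; when
   [F] is continuous this is every t > t0. *)
Definition trajectory (R : realType) (n : nat) (F : R -> 'rV[R]_n -> 'rV[R]_n)
    (t0 : R) (x0 : 'rV[R]_n) (x : R -> 'rV[R]_n) : Prop :=
  [/\ x t0 = x0,
      {within [set t | t0 <= t], continuous x}
    & forall t, t0 < t -> {for t, continuous (F ^~ (x t))} ->
        is_derive t 1 x (F t (x t))].

(* Uniformity: [chi] depends neither on the initial time nor on the initial
   state.  Trajectories are required to exist for all t >= t0. *)
Definition GUAS (R : realType) (n : nat)
    (F : R -> 'rV[R]_n -> 'rV[R]_n) : Prop :=
  admissible_system F /\
  exists chi : R -> R -> R, class_kl +oo%E chi /\
    forall (t0 : R) (x0 : 'rV[R]_n),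
      (exists x, trajectory F t0 x0 x) /\
      (forall x, trajectory F t0 x0 x ->
         forall t, t0 <= t -> enorm (x t) <= chi (enorm x0) (t - t0)).

Definition smooth (R : realType) (f : R -> R) : Prop :=
  forall (m : nat) (z : R), derivable (derive1n m f) z 1.

Definition rvec (R : realType) (n : nat) (s : seq R) : 'rV[R]_n :=
  \row_(i < n) s`_i.

(* State x = (z, psi, ubar, r), input tau = (taubar1, tau2). *)
Definition plant (R : realType) (x : 'rV[R]_4) (tau : 'rV[R]_2) : 'rV[R]_4 :=
  let u := x 0 2 in let r := x 0 3 in
  rvec 4 [:: - (u * r); r; tau 0 0; tau 0 1].

Definition control_law (R : realType) (k1 k2 k3 k4 : R) (f : R -> R)
    (t : R) (x : 'rV[R]_4) : 'rV[R]_2 :=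
  let z := x 0 0 in let psi := x 0 1 in let u := x 0 2 in let r := x 0 3 in
  rvec 2 [:: k1 * z * r - k2 * u; - k3 * psi - k4 * r + f z * cos t].

Definition closed_loop (R : realType) (k1 k2 k3 k4 : R) (f : R -> R)
    (t : R) (x : 'rV[R]_4) : 'rV[R]_4 :=
  plant x (control_law k1 k2 k3 k4 f t x).

(* Main.v *)
(* Write V = k1 z^2 + u^2, q = - k3 psi + f(z) cos t, and call [df] the
   derivative of f. Along solutions V' = - 2 k2 u^2, so z and u stay bounded, and
   (psi, r) is a damped linear oscillator forced by f(z) cos t; this gives
   boundedness and stability, uniformly in the initial time.
   Attractivity comes from nested Matrosov functions: modulo multiples of the
   quantities already dominated by the previous ones, the derivatives of
     V,  - z r u,  - z^2 r q,  2 z^2 q f sin t - z^2 f^2 sin t cos t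
   are - 2 k2 u^2, - k1 (z r)^2, - (z q)^2 and - z^2 f(z)^2. A suitable combination
   has derivative bounded by a negative constant as long as V >= d and the state
   remains in a fixed box, so V falls below d within a time depending only on d and
   on the box; then (psi, r) decays exponentially up to an error that is small with
   sup { |f(z)| : k1 z^2 <= d }.
   A class kl bound is extracted from these epsilon-delta properties by taking a
   supremum against kernels that are locally Lipschitz in (r, s). *)
Require Import Defs.
From mathcomp Require Import all_boot all_order all_algebra.
From mathcomp Require Import all_classical all_reals all_analysis.
From mathcomp Require Import ring lra.
Import Order.TTheory GRing.Theory Num.Theory.
Import numFieldNormedType.Exports.
Local Open Scope classical_set_scope.
Local Open Scope ring_scope.
Set Implicit Arguments.
Unset Strict Implicit.
Unset Printing Implicit Defensive.

(** * Calculus on a half-line *)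

(* Requiring continuity on all of R, and not only on [[t0, +oo[], avoids subspace
   topologies; trajectories are made constant before t0 to fit. *)
Definition C1_after (R : realType) (t0 : R) (g dg : R -> R) : Prop :=
  continuous g /\ forall t, t0 < t -> is_derive t 1 g (dg t).

Section C1After.
Variables (R : realType) (t0 : R).
Implicit Types f g df dg : R -> R.

Lemma C1_after_eq g dg dg' : C1_after t0 g dg ->
  (forall t, t0 < t -> dg t = dg' t) -> C1_after t0 g dg'.
Proof. by move=> [cg Dg] e; split=> // t tt; rewrite -e//; exact: Dg. Qed.

Lemma C1_after_cst c : C1_after t0 (fun=> c) (fun=> 0).
Proof. by split=> [t|t _]; [exact: cst_continuous|exact: is_derive_cst]. Qed.

Lemma C1_after_id : C1_after t0 id (fun=> 1).
Proof. by split=> [t|t _]; [exact: id|exact: is_derive_id]. Qed.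

Lemma C1_afterD f df g dg : C1_after t0 f df -> C1_after t0 g dg ->
  C1_after t0 (fun t => f t + g t) (fun t => df t + dg t).
Proof.
move=> [cf Df] [cg Dg]; split=> [t|t tt]; first by apply: cvgD; [exact: cf|exact: cg].
by apply: (@is_deriveD _ _ _ f g); [exact: Df|exact: Dg].
Qed.

Lemma C1_afterN f df : C1_after t0 f df ->
  C1_after t0 (fun t => - f t) (fun t => - df t).
Proof.
move=> [cf Df]; split=> [t|t tt]; first by apply: cvgN; exact: cf.
by apply: (@is_deriveN _ _ _ f); exact: Df.
Qed.

Lemma C1_afterM f df g dg : C1_after t0 f df -> C1_after t0 g dg ->
  C1_after t0 (fun t => f t * g t) (fun t => df t * g t + f t * dg t).
Proof.
move=> [cf Df] [cg Dg]; split=> [t|t tt]; first by apply: cvgM; [exact: cf|exact: cg].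
apply: is_derive_eq; first by apply: (@is_deriveM _ _ f g); [exact: Df|exact: Dg].
by rewrite /GRing.scale/=; ring.
Qed.

Lemma C1_after_sqr f df : C1_after t0 f df ->
  C1_after t0 (fun t => f t ^+ 2) (fun t => 2 * f t * df t).
Proof. by move=> Df; apply: C1_after_eq (C1_afterM Df Df) _ => t _ /=; ring. Qed.

Lemma C1_after_comp f f' g dg : (forall y : R, is_derive y 1 f (f' y)) ->
  C1_after t0 g dg -> C1_after t0 (fun t => f (g t)) (fun t => f' (g t) * dg t).
Proof.
move=> Df [cg Dg]; split=> [t|t tt].
  apply: (@continuous_comp _ _ _ g f t); first exact: cg.
  by apply: differentiable_continuous; apply/derivable1_diffP; case: (Df (g t)).
exact: (@is_derive1_comp _ f g t _ _ (Df _) (Dg _ tt)).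
Qed.

Lemma C1_after_nincr f df a b : C1_after t0 f df -> t0 <= a -> a <= b ->
  (forall t, a < t < b -> df t <= 0) -> f b <= f a.
Proof.
move=> [cf Df] ta; rewrite le_eqVlt => /predU1P[->//|ab] df0; rewrite -subr_le0.
have [t|c + ->] := MVT (f := f) (df := df) ab _ (continuous_subspaceT cf).
  by rewrite in_itv/= => /andP[a_t _]; apply: Df; exact: le_lt_trans a_t.
by rewrite in_itv/= => /df0 c0; rewrite mulr_le0_ge0// subr_ge0 ltW.
Qed.

End C1After.

(** * Bounds for continuous functions on a segment *)

Section SegmentBounds.
Variables (R : realType) (f : R -> R) (cf : continuous f).

Lemma continuous_norm_le M : exists2 C, 0 <= C & forall x, `|x| <= M -> `|f x| <= C.
Proof.
have [M0|M0] := leP 0 M; last first.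
  by exists 0 => // x /le_lt_trans/(_ M0); rewrite ltNge normr_ge0.
have [||c _ cmax] := @EVT_max R (fun x => `|f x|) (- M) M.
- by rewrite ge0_cp.
- by apply: continuous_subspaceT => x; apply: cvg_norm; exact: cf.
by exists `|f c| => // x; rewrite ler_norml => xM; apply: cmax; rewrite in_itv.
Qed.

(** The condition [a <= x ^+ 2] leaves two pieces of [[- M, M]], one on each side of 0. The
    penalised function [h] is positive on the whole segment, so a single minimum serves both. *)
Lemma continuous_sqr_ge a M : 0 < a -> (forall x, x != 0 -> f x != 0) ->
  exists2 m, 0 < m & forall x, a <= x ^+ 2 -> `|x| <= M -> m <= x ^+ 2 * f x ^+ 2.
Proof.
move=> a0 f0; have [M0|M0] := leP 0 M; last first.
  by exists 1 => // x _ /le_lt_trans/(_ M0); rewrite ltNge normr_ge0.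
(* the added term vanishes where [a <= x ^+ 2] and makes h positive at 0 *)
pose h x := x ^+ 2 * f x ^+ 2 + (a - x ^+ 2 + `|a - x ^+ 2|).
have ch : continuous h.
  move=> x; apply: cvgD.
    by apply: cvgM; apply: cvgM; [exact: id|exact: id|exact: cf|exact: cf].
  have ca : continuous (fun y : R => a - y ^+ 2).
    by move=> y; apply: cvgB; [exact: cvg_cst|apply: cvgM; exact: id].
  by apply: cvgD; [|apply: cvg_norm]; exact: ca.
have [|c _ cmin] := @EVT_min R h (- M) M _ (continuous_subspaceT ch).
  by rewrite ge0_cp.
exists (h c) => [|x ax xM].
  have [->|c0] := eqVneq c 0.
    by rewrite /h expr0n mul0r add0r subr0 gtr0_norm// addr_gt0.
  apply: ltr_pwDl; last by rewrite -lerBlDl sub0r -normrN ler_norm.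
  by rewrite mulr_gt0// exprn_even_gt0//= f0.
apply: le_trans (cmin x _) _; first by rewrite in_itv/= -ler_norml.
by rewrite /h ler0_norm ?subrr ?addr0// subr_le0.
Qed.

End SegmentBounds.

(** * Global solutions of globally Lipschitz equations *)

Section RowVectors.
Variables (R : realType) (n : nat).
Implicit Types x : 'rV[R]_n.

Lemma normr_coord_le x i : `|x 0 i| <= `|x|.
Proof.
rewrite [leRHS]/Num.Def.normr/= mx_normrE.
exact: (le_bigmax _ (fun i : 'I_1 * 'I_n => `|x i.1 i.2|) (0, i)).
Qed.

Lemma normr_row_le x c : 0 <= c -> (forall i, `|x 0 i| <= c) -> `|x| <= c.
Proof.
move=> c0 xc; rewrite [leLHS]/Num.Def.normr/= mx_normrE.
by apply: bigmax_le => //= -[j i] _; rewrite ord1.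
Qed.

Lemma continuous_rowP (T : topologicalType) (x : T -> 'rV[R]_n) :
  (forall i, continuous (fun t => x t 0 i)) -> continuous x.
Proof.
move=> cx t; apply/cvgrPdist_le => e e0.
near=> s; apply: normr_row_le; first exact: ltW.
move=> i; rewrite !mxE; move: i; near: s; apply: filter_forall => i.
by have /cvgrPdist_le := cx i t; exact.
Unshelve. all: by end_near. Qed.

Lemma is_derive_rowP (x : R -> 'rV[R]_n) (t : R) (v : 'rV[R]_n) :
  is_derive t 1 x v <-> forall i, is_derive t 1 (fun s => x s 0 i) (v 0 i).
Proof.
split=> [[dx <-] i|dx].
  have /derivable_mxP/(_ 0 i) dxi := dx.
  by split=> //; rewrite derive_mx// mxE.
have xt : derivable x t 1.
  by apply/derivable_mxP => j i; rewrite ord1; case: (dx i).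
split=> //; apply/rowP => i; rewrite derive_mx// mxE.
by case: (dx i).
Qed.

End RowVectors.

(** * Primitives on a half-line and exponential bounds *)

Section Primitive.
Variable R : realType.

Lemma continuous_clamp_past (t0 : R) : continuous (fun t => Num.max t t0).
Proof. by move=> t; apply: (continuous_max (f := id)); [exact: id|exact: cst_continuous]. Qed.

Lemma C1_after_clamp_past (t0 : R) g dg :
  {within [set t | t0 <= t], continuous g} ->
  (forall t, t0 < t -> is_derive t 1 g (dg t)) ->
  C1_after t0 (fun t => g (Num.max t t0)) dg.
Proof.
move=> /subspace_continuousP cg Dg; split=> [t|t tt].
  have t0_le s : t0 <= Num.max s t0 by rewrite le_max lexx orbT.
  apply: (@cvg_comp _ _ _ (fun t => Num.max t t0) g _ _ _ _ (cg _ (t0_le t))) => P nP.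
  have tP : nbhs t ((fun s => Num.max s t0) @^-1` [set s | t0 <= s -> P s]).
    exact: continuous_clamp_past nP.
  suff : nbhs t ((fun s => Num.max s t0) @^-1` P) by [].
  by apply: filterS tP => s /(_ (t0_le s)).
apply: near_eq_is_derive (Dg _ tt); near=> s.
by rewrite max_l// ltW//; near: s; exact: lt_nbhsr.
Unshelve. all: by end_near. Qed.

Lemma continuous_primitive (t0 c : R) (g : R -> R) : continuous g ->
  exists2 G, C1_after t0 G g & G t0 = c.
Proof.
(* Integrating from [t0 - 1] makes [t0] an interior point, so that [F] is differentiable, hence
   continuous, at [t0] itself. *)
move=> cg; pose F x := (\int[lebesgue_measure]_(t in `[t0 - 1, x]) g t)%R.
have DF t : t0 - 1 < t -> is_derive t 1 F (g t).
  move=> tt; have [||dF F'] := @continuous_FTC1_closed R g (t0 - 1) t (t + 1) _ _ tt (cg t).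
  - by rewrite ltrDl.
  - apply: continuous_compact_integrable; first exact: segment_compact.
    exact: continuous_subspaceT.
  exact: (DeriveDef dF (etrans (esym (derive1E _ _)) F')).
exists (fun t => F (Num.max t t0) + (c - F t0)); last first.
  by rewrite maxxx addrC subrK.
have /C1_afterD/(_ (C1_after_cst t0 (c - F t0))) : C1_after t0 (fun t => F (Num.max t t0)) g.
  apply: C1_after_clamp_past => [|t tt].
    apply: continuous_in_subspaceT => t; rewrite inE/= => tt.
    apply: differentiable_continuous; apply/derivable1_diffP.
    by case: (DF t) => //; lra.
  by apply: DF; lra.
by move/C1_after_eq; apply => t _; rewrite addr0.
Qed.

Lemma C1_after_expR (t0 l a : R) :
  C1_after t0 (fun t => expR (l * (t - a))) (fun t => l * expR (l * (t - a))).
Proof.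
have := C1_after_comp (@is_derive_expR R) (C1_afterM (C1_after_cst t0 l)
  (C1_afterD (C1_after_id t0) (C1_after_cst t0 (- a)))).
by move/C1_after_eq; apply => t _ /=; ring.
Qed.

(** The function [K / l * expR (l * (t - t0))] has the assumed bound as its derivative, so
    subtracting it from [g] or from [- g] leaves a nonincreasing function. The gain [1 / l] is what
    makes the Picard operator contract in a weighted norm. *)
Lemma C1_after_expR_bound (t0 l K : R) g dg : 0 < l -> 0 <= K -> C1_after t0 g dg ->
  g t0 = 0 -> (forall t, t0 < t -> `|dg t| <= K * expR (l * (t - t0))) ->
  forall t, t0 <= t -> `|g t| <= K / l * expR (l * (t - t0)).
Proof.
move=> l0 K0 Dg g0 dgK.
have one_sided h dh : C1_after t0 h dh -> h t0 = 0 ->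
    (forall t, t0 < t -> `|dh t| <= K * expR (l * (t - t0))) ->
    forall t, t0 <= t -> h t <= K / l * expR (l * (t - t0)).
  move=> Dh h0 dhK t tt.
  have := C1_after_nincr (C1_afterD Dh (C1_afterN
    (C1_afterM (C1_after_cst t0 (K / l)) (C1_after_expR t0 l t0)))) (lexx t0) tt.
  rewrite h0 subrr mulr0 expR0 mulr1 sub0r => H.
  have : h t - K / l * expR (l * (t - t0)) <= - (K / l).
    apply: H => s /andP[ss _]; have := dhK _ ss.
    rewrite mul0r add0r mulrA divfK ?gt_eqF// subr_le0; apply: le_trans.
    exact: ler_norm.
  move=> H'; rewrite -subr_le0; apply: le_trans H' _.
  by rewrite oppr_le0 divr_ge0// ltW.
move=> t tt; rewrite ler_norml; apply/andP; split; last exact: (one_sided g dg).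
rewrite lerNl; apply: (one_sided _ _ (C1_afterN Dg)) => //; first by rewrite g0 oppr0.
by move=> s ss; rewrite normrN; exact: dgK.
Qed.

End Primitive.

(** * Picard iteration in an exponentially weighted norm *)

Section Picard.
Variables (R : realType) (n : nat) (F : R -> 'rV[R]_n -> 'rV[R]_n).
Variables (L C t0 : R) (x0 : 'rV[R]_n).
Hypothesis L0 : 0 < L.
Hypothesis FL : forall t v w, `|F t v - F t w| <= L * `|v - w|.
Hypothesis FC : forall t, `|F t x0| <= C.
Hypothesis cF : forall x, continuous x -> continuous (fun t => F t (x t)).

Lemma continuous_primitive_row (g : R -> 'rV[R]_n) : continuous g ->
  exists G : R -> 'rV[R]_n, G t0 = x0 /\
    forall i, C1_after t0 (fun t => G t 0 i) (fun t => g t 0 i).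
Proof.
move=> cg.
have cgi i : continuous (fun t => g t 0 i).
  by move=> t; apply: (@continuous_comp _ _ _ g (fun v : 'rV_n => v 0 i));
    [exact: cg|exact: coord_continuous].
have /choice[G HG] (i : 'I_n) : exists G, C1_after t0 G (fun t => g t 0 i) /\ G t0 = x0 0 i.
  by have [G ? ?] := continuous_primitive t0 (x0 0 i) (cgi i); exists G.
exists (fun t => \row_i G i t); split; first by apply/rowP => i; rewrite mxE; case: (HG i).
move=> i; rewrite [X in C1_after _ X](_ : _ = G i); first by case: (HG i).
by apply/funext => t; rewrite mxE.
Qed.

(* the primitive of g with value x0 at t0 *)
Let prim (g : R -> 'rV[R]_n) : R -> 'rV[R]_n :=
  if pselect (continuous g) is left cg then projT1 (cid (continuous_primitive_row cg))
  else cst x0.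

Let primP g : continuous g -> prim g t0 = x0 /\
  forall i, C1_after t0 (fun t => prim g t 0 i) (fun t => g t 0 i).
Proof. by rewrite /prim; case: pselect => // cg _; case: cid. Qed.

(* In the norm weighted by [expR (- l * (t - t0))], the Picard operator is a
   contraction of ratio [L / l = 1 / 2], on the whole half-line. *)
Let l := 2 * L.
Let l0 : 0 < l. Proof. exact: mulr_gt0. Qed.
Let C0 : 0 <= C. Proof. exact: le_trans (normr_ge0 _) (FC 0). Qed.

Fixpoint picard k : R -> 'rV[R]_n :=
  if k is k'.+1 then prim (fun t => F t (picard k' t)) else cst x0.

Let continuous_picard k : continuous (picard k).
Proof.
elim: k => [|k IH] /=; first exact: cst_continuous.
apply: continuous_rowP => i.
by have [_ /(_ i) []] := primP (cF IH).
Qed.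

Let prim_contraction g h K : 0 <= K -> continuous g -> continuous h ->
  (forall t, t0 <= t -> `|g t - h t| <= K * expR (l * (t - t0))) ->
  forall t, t0 <= t -> `|prim (fun t => F t (g t)) t - prim (fun t => F t (h t)) t|
    <= K / 2 * expR (l * (t - t0)).
Proof.
move=> K0 cg ch ghK t tt.
have [g0 Dg] := primP (cF cg); have [h0 Dh] := primP (cF ch).
apply: normr_row_le => [|i].
  by rewrite mulr_ge0 ?expR_ge0// divr_ge0.
rewrite [K / 2](_ : _ = L * K / l); last by rewrite /l; field; rewrite gt_eqF.
have := @C1_after_expR_bound R t0 l (L * K) _ _ l0 (mulr_ge0 (ltW L0) K0)
  (C1_afterD (Dg i) (C1_afterN (Dh i))) _ _ t tt.
rewrite !mxE; apply; first by rewrite g0 h0 subrr.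
move=> s ss; have := normr_coord_le (F s (g s) - F s (h s)) i; rewrite !mxE => /le_trans.
apply; apply: le_trans (FL _ _ _) _; rewrite -mulrA ler_pM2l//.
by apply: ghK; exact: ltW.
Qed.

Let picard_step k t : t0 <= t ->
  `|picard k.+1 t - picard k t| <= C / l * 2^-1 ^+ k * expR (l * (t - t0)).
Proof.
elim: k t => [|k IH] t tt; last first.
  rewrite exprSr mulrA.
  apply: (prim_contraction _ (@continuous_picard k.+1) (@continuous_picard k)) => //.
  by rewrite mulr_ge0 ?exprn_ge0 ?divr_ge0// ltW.
rewrite expr0 mulr1 /=; have [p0 Dp] := primP (cF (@cst_continuous _ _ x0)).
apply: normr_row_le => [|i]; first by rewrite mulr_ge0 ?expR_ge0// divr_ge0// ltW.
have := @C1_after_expR_bound R t0 l C _ _ l0 C0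
  (C1_afterD (Dp i) (C1_after_cst t0 (- x0 0 i))) _ _ t tt.
rewrite !mxE; apply; first by rewrite p0 subrr.
move=> s ss; rewrite addr0 (le_trans (normr_coord_le _ _))// (le_trans (FC _))//.
by rewrite ler_peMr// -expR0 ler_expR mulr_ge0 ?subr_ge0// ltW.
Qed.

Let picard_dist k m t : t0 <= t ->
  `|picard (k + m) t - picard k t| <= 2 * (C / l) * 2^-1 ^+ k * expR (l * (t - t0)).
Proof.
move=> tt; set c := expR _.
have c0 : 0 <= C / l * c by rewrite mulr_ge0 ?expR_ge0// divr_ge0// ltW.
(* The factor [1 - 2^-1 ^+ m] of the partial geometric sum makes the induction on [m] close. *)
suff : `|picard (k + m) t - picard k t| <=
    2 * (C / l * c) * 2^-1 ^+ k * (1 - 2^-1 ^+ m).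
  move=> /le_trans; apply; rewrite [leRHS](_ : _ = 2 * (C / l * c) * 2^-1 ^+ k); last by ring.
  apply: ler_piMr; last by rewrite gerBl exprn_ge0 ?invr_ge0.
  by apply: mulr_ge0; [exact: mulr_ge0|rewrite exprn_ge0 ?invr_ge0].
elim: m => [|m IH]; first by rewrite addn0 subrr normr0 expr0 subrr mulr0.
rewrite addnS (le_trans (ler_distD (picard (k + m) t) _ _))//.
apply: le_trans (lerD (picard_step _ tt) IH) _.
rewrite -/c exprD exprS le_eqVlt; apply/orP; left; apply/eqP; field.
by rewrite gt_eqF.
Qed.

Lemma cauchy_lipschitz : exists x : R -> 'rV[R]_n, x t0 = x0 /\
  forall i, C1_after t0 (fun t => x t 0 i) (fun t => F t (x t) 0 i).
Proof.
(* The contraction estimates hold only after [t0], so the iterates are frozen before it to converge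
   on all of R. *)
pose p k t := picard k (Num.max t t0).
pose c t := 2 * (C / l) * expR (l * (Num.max t t0 - t0)).
have c0 t : 0 <= c t by rewrite !mulr_ge0 ?expR_ge0// invr_ge0 ltW.
have pk k m t : `|p (k + m)%N t - p k t| <= c t * 2^-1 ^+ k.
  by rewrite /c mulrAC; apply: picard_dist; rewrite le_max lexx orbT.
have half0 (a : R) : 0 <= a -> forall e, 0 < e -> \forall k \near \oo, a * 2^-1 ^+ k <= e.
  move=> a0 e e0.
  have /cvgrPdist_le/(_ e e0) : geometric a 2^-1 @ \oo --> (0 : R).
    by apply: cvg_geometric; rewrite ger0_norm ?invr_ge0// invf_lt1 ?ltr1n.
  apply: filterS => k; rewrite sub0r normrN /geometric /=; exact/le_trans/ler_norm.
have pcvg t : cvgn (p ^~ t).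
  apply/cauchy_cvgP/cauchy_exP => e e0.
  have [N _ /(_ N (leqnn N)) HN] := half0 _ (c0 t) _ (divr_gt0 e0 (ltr0Sn _ 1)).
  exists (p N t); rewrite /=; exists N => // k /= Nk; rewrite -ball_normE/= -(subnKC Nk).
  rewrite distrC (le_lt_trans (pk _ _ _))// (le_lt_trans HN)// ltr_pdivrMr//.
  by rewrite ltr_pMr// ltr1n.
pose x t := limn (p ^~ t).
have px k t : `|x t - p k t| <= c t * 2^-1 ^+ k.
  have : (fun m => `|p (m + k)%N t - p k t|) @ \oo --> `|x t - p k t|.
    apply: cvg_norm; apply: cvgB; last exact: cvg_cst.
    by rewrite (cvg_shiftn k (p ^~ t) (nbhs (x t))); exact: pcvg.
  move=> H; rewrite -(cvg_lim _ H)//; apply: limr_le; first by apply/cvg_ex; eexists; exact: H.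
  by apply: nearW => m; rewrite addnC.
have cp k : continuous (p k).
  by move=> t; apply: (@continuous_comp _ _ _ (fun t => Num.max t t0) (picard k));
    [exact: continuous_clamp_past|exact: continuous_picard].
have cc : continuous c.
  move=> t; apply: cvgM; first exact: cvg_cst.
  apply: (@continuous_comp _ _ _ (fun t => l * (Num.max t t0 - t0)) expR); last exact: continuous_expR.
  apply: cvgM; first exact: cvg_cst.
  by apply: cvgB; [exact: continuous_clamp_past|exact: cvg_cst].
have cx : continuous x.
  move=> t; apply/cvgrPdist_le => e e0.
  have e3 : 0 < e / 3 by rewrite divr_gt0.
  have [k _ /(_ k (leqnn k)) Hk] := half0 (c t + 1) (addr_ge0 (c0 t) ler01) _ e3.
  near=> s.
  have cs : c s <= c t + 1.
    near: s; have /cvgrPdist_le/(_ 1 ltr01) := cc t.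
    by apply: filterS => s; rewrite ler_distl lerBlDr => /andP[].
  rewrite (le_trans (ler_distD (p k t) _ _))// (_ : e = e / 3 + (e / 3 + e / 3)); last by field.
  apply: lerD.
    by rewrite (le_trans (px _ _))// (le_trans _ Hk)// ler_wpM2r ?exprn_ge0// lerDl.
  rewrite (le_trans (ler_distD (p k s) _ _))//; apply: lerD.
    by near: s; have /cvgrPdist_le := cp k t; exact.
  by rewrite distrC (le_trans (px _ _))// (le_trans _ Hk)// ler_wpM2r ?exprn_ge0.
(* One more application of the Picard operator to the limit gives a function [y] whose derivative is
   known; the contraction then identifies [y] with [x] after [t0]. *)
have [y0 Dy] := primP (cF cx); set y := prim _ in y0 Dy.
have yx t : t0 <= t -> y t = x t.
  move=> tt; apply/eqP; rewrite -subr_eq0 -normr_le0; apply/ler_addgt0Pl => e e0.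
  rewrite addr0.
  have [k _ /(_ k (leqnn k)) Hk] := half0 _ (c0 t) _ e0.
  have ct : c t = 2 * (C / l) * expR (l * (t - t0)) by rewrite /c max_l.
  rewrite (le_trans (ler_distD (p k.+1 t) _ _))// (le_trans _ Hk)//.
  rewrite (_ : c t * _ = c t * 2^-1 ^+ k / 2 + c t * 2^-1 ^+ k / 2); last by field.
  apply: lerD; last by rewrite distrC (le_trans (px _ _))// exprSr mulrA.
  rewrite {1}/p max_l// ct.
  apply: le_trans (prim_contraction (K := 2 * (C / l) * 2^-1 ^+ k) _ cx (@continuous_picard k) _ tt) _.
  - by rewrite !mulr_ge0 ?exprn_ge0// invr_ge0 ltW.
  - by move=> s ss; have := px k s; rewrite /p /c max_l// mulrAC.
  - by rewrite le_eqVlt; apply/orP; left; apply/eqP; field; rewrite gt_eqF.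
exists y; split=> // i; apply: C1_after_eq (Dy i) _ => t tt.
by rewrite yx// ltW.
Unshelve. all: by end_near. Qed.

End Picard.

(** * From epsilon-delta bounds to a class kl bound *)

Section KLMajorant.
(* [D rho sigma v]: some trajectory starting at distance rho is at distance v
   after time sigma. *)
Variables (R : realType) (D : R -> R -> R -> Prop).
Hypothesis D_ge0 : forall rho sigma v, D rho sigma v -> 0 <= rho /\ 0 <= v.
Hypothesis D_bounded : forall M, exists B,
  forall rho sigma v, D rho sigma v -> rho <= M -> v <= B.
Hypothesis D_stable : forall e, 0 < e -> exists2 d, 0 < d &
  forall rho sigma v, D rho sigma v -> rho <= d -> v <= e.
Hypothesis D_attractive : forall M e, 0 < e -> exists T,
  forall rho sigma v, D rho sigma v -> rho <= M -> T <= sigma -> v <= e.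

Let clamp (x : R) := Num.max 0 (Num.min 1 x).

Let clamp_ge0 x : 0 <= clamp x. Proof. by rewrite /clamp le_max lexx. Qed.

Let clamp_le1 x : clamp x <= 1.
Proof. by rewrite /clamp ge_max ler01 ge_min lexx. Qed.

Let clamp_eq0 x : x <= 0 -> clamp x = 0.
Proof. by move=> x0; rewrite /clamp max_l// ge_min x0 orbT. Qed.

Let clamp_le x y : x <= y -> clamp x <= clamp y.
Proof. by move=> xy; rewrite /clamp /Num.max /Num.min; case: (ltP 1 x) => ?; case: (ltP 1 y) => ?; do !case: ltP => ?; lra. Qed.

Let clamp_dist1 x y : clamp x <= clamp y + `|x - y|.
Proof.
rewrite /clamp ge_max ge_min; apply/andP; split.
  by rewrite addr_ge0// le_max lexx.
move: (ler_norm (x - y)) (normr_ge0 (x - y)); move: `|x - y| => d xyd d0.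
by rewrite /Num.max /Num.min; case: (ltP 1 x) => ?; case: (ltP 1 y) => ?; do !case: ltP => ?; lra.
Qed.

Let clamp_dist x y : `|clamp x - clamp y| <= `|x - y|.
Proof.
by rewrite ler_distl lerBlDr clamp_dist1 andbT distrC clamp_dist1.
Qed.

(* equals 1 for [rho <= r] and 0 for [2 * r <= rho]; also 0 at [r = 0], where
   division gives 0 *)
Let kr rho r := clamp ((2 * r - rho) / r).
(** Equals 1 for [s <= sigma] and 0 for [sigma + 1 <= s], so that data from times well before [s]
    are ignored. *)
Let ks sigma s := clamp (1 + sigma - s).

(** The value 0 is included so that the supremum is over a nonempty set and is nonnegative. *)
Let weighted r s : set R := [set y | y = 0 \/
  exists rho sigma v, D rho sigma v /\ y = v * (kr rho r * ks sigma s)].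

Let X r s := sup (weighted r s).

Let kr_le rho r r' : 0 <= rho -> 0 <= r -> r <= r' -> kr rho r <= kr rho r'.
Proof.
move=> rho0 r0 rr'; move: r0; rewrite le_eqVlt => /predU1P[<-|r0].
  by rewrite {1}/kr clamp_eq0 ?invr0 ?mulr0//; exact: clamp_ge0.
apply: clamp_le; have r'0 := lt_le_trans r0 rr'.
rewrite ler_pdivrMr// mulrAC ler_pdivlMr//.
nra.
Qed.

(** The kernels localise: only data with [rho <= 2 * r] and [s - 1 <= sigma] contribute. This is how
    boundedness, stability and attractivity pass from [D] to [X]. *)
Let weighted_cases rho sigma v r s : D rho sigma v -> 0 <= r ->
  v * (kr rho r * ks sigma s) = 0 \/ [/\ 0 < r, rho <= 2 * r, s - 1 <= sigma &
  0 <= v * (kr rho r * ks sigma s) <= v].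
Proof.
move=> Dv; have [rho0 v0] := D_ge0 Dv; rewrite le_eqVlt => /predU1P[<-|r0].
  by left; rewrite /kr clamp_eq0 ?invr0 ?mulr0// mul0r mulr0.
have [h|h] := leP (2 * r) rho.
  left; rewrite /kr clamp_eq0 ?mul0r ?mulr0//.
  by apply: mulr_le0_ge0; [lra|rewrite invr_ge0; lra].
have [h'|h'] := leP sigma (s - 1).
  by left; rewrite /ks clamp_eq0 ?mulr0//; lra.
right; split=> //; [exact: ltW|exact: ltW|].
have [k0 l0] : 0 <= kr rho r /\ 0 <= ks sigma s by split; exact: clamp_ge0.
by rewrite !mulr_ge0//= ler_piMr// mulr_ile1//; exact: clamp_le1.
Qed.

Let weighted_neq0 r s : weighted r s !=set0. Proof. by exists 0; left. Qed.

Let weighted_sup r s : 0 <= r -> has_sup (weighted r s).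
Proof.
move=> r0; split=> //; have [B HB] := D_bounded (2 * r).
exists `|B| => y [->//|[rho [sigma [v [Dv ->]]]]].
have [->//|[_ h _ /andP[_ hv]]] := weighted_cases s Dv r0.
exact: le_trans hv (le_trans (HB _ _ _ Dv h) (ler_norm _)).
Qed.

Let X_ge0 r s : 0 <= r -> 0 <= X r s.
Proof. by move=> r0; apply: ub_le_sup; [case: (weighted_sup s r0)|left]. Qed.

Let X_le r s c : 0 <= r -> 0 <= c ->
  (forall rho sigma v, D rho sigma v -> 0 < r -> rho <= 2 * r -> s - 1 <= sigma -> v <= c) ->
  X r s <= c.
Proof.
move=> r0 c0 vc; apply: ge_sup => // y [->//|[rho [sigma [v [Dv ->]]]]].
have [->//|[r0' h h' /andP[_ hv]]] := weighted_cases s Dv r0.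
exact: le_trans hv (vc _ _ _ Dv _ _ _).
Qed.

Let X_dist r s r' s' c : 0 <= r -> 0 <= r' -> 0 <= c ->
  (forall rho sigma v, D rho sigma v ->
    v * (kr rho r * ks sigma s) <= v * (kr rho r' * ks sigma s') + c) ->
  X r s <= X r' s' + c.
Proof.
move=> r0 r0' c0 vc; apply: ge_sup => // y [->|[rho [sigma [v [Dv ->]]]]].
  by rewrite addr_ge0// X_ge0.
apply: le_trans (vc _ _ _ Dv) _; rewrite lerD2r; apply: ub_le_sup.
  by case: (weighted_sup s' r0').
by right; exists rho, sigma, v.
Qed.

(** For positive [rho] both kernels equal 1 at [r = rho], [s = sigma]. At [rho = 0] the first kernel
    vanishes, but stability forces [v <= 0] there. *)
Let X_majorant rho sigma v : D rho sigma v -> v <= X rho sigma.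
Proof.
move=> Dv; have [rho0 v0] := D_ge0 Dv; move: rho0 (rho0).
rewrite {1}le_eqVlt => /predU1P[rho0 rho0'|rho0 rho0'].
  apply: le_trans (X_ge0 _ rho0'); apply/ler_addgt0Pl => e e0; rewrite addr0.
  by have [d d0] := D_stable e0; apply; [exact: Dv|rewrite -rho0 ltW].
apply: ub_le_sup; first by case: (weighted_sup sigma rho0').
right; exists rho, sigma, v; split=> //.
rewrite /kr /ks (_ : _ / rho = 1); last by field; rewrite gt_eqF.
by rewrite addrK /clamp minxx max_r// !mulr1.
Qed.

Let X_ndecr r r' s : 0 <= r -> r <= r' -> X r s <= X r' s.
Proof.
move=> r0 rr'; rewrite -[leRHS]addr0; apply: X_dist => //; first exact: le_trans rr'.
move=> rho sigma v Dv; have [rho0 v0] := D_ge0 Dv; rewrite addr0.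
by rewrite ler_wpM2l// ler_wpM2r ?kr_le//; exact: clamp_ge0.
Qed.

Let X_nincr r s s' : 0 <= r -> s <= s' -> X r s' <= X r s.
Proof.
move=> r0 ss'; rewrite -[leRHS]addr0; apply: X_dist => //.
move=> rho sigma v Dv; have [rho0 v0] := D_ge0 Dv; rewrite addr0.
rewrite ler_wpM2l// ler_wpM2l//; first exact: clamp_ge0.
by apply: clamp_le; rewrite lerD2l lerN2.
Qed.

Let X0 s : X 0 s = 0.
Proof.
apply/eqP; rewrite eq_le X_ge0// andbT; apply: X_le => // ? ? ? _.
by rewrite ltxx.
Qed.

Let X_cvg0 r : 0 <= r -> X r s @[s --> +oo] --> 0.
Proof.
move=> r0; apply/cvgrPdist_le => e e0.
have [T HT] := D_attractive (2 * r) e0.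
near=> s; rewrite sub0r normrN ger0_norm ?X_ge0//.
apply: X_le => //; first exact: ltW.
move=> rho sigma v Dv _ h h'; apply: (HT _ _ _ Dv h); apply: le_trans h'.
by rewrite lerBrDr; near: s; apply: nbhs_pinfty_ge; exact: num_real.
Unshelve. all: by end_near. Qed.

(** The difference is [rho / (r * r0) * (r - r0)], and [rho <= 4 * r0], [r0 / 2 <= r] bound the
    quotient by [8 / r0]. *)
Let kr_dist (rho r r0 : R) : 0 < r0 -> r0 / 2 <= r -> r <= 2 * r0 ->
  0 <= rho <= 4 * r0 -> `|(2 * r - rho) / r - (2 * r0 - rho) / r0| <= 8 / r0 * `|r - r0|.
Proof.
move=> r00 rl ru /andP[rho0 rho4]; have r0' : 0 < r by lra.
rewrite [X in `|X|](_ : _ = rho / (r * r0) * (r - r0)); last by field; rewrite !gt_eqF.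
rewrite normrM ler_wpM2r// ger0_norm; last by rewrite divr_ge0// mulr_ge0// ltW.
by rewrite ler_pdivrMr ?mulr_gt0// [leRHS](_ : _ = 8 * r); [lra|field; rewrite gt_eqF].
Qed.

(** At [r0 = 0], where the kernel degenerates, continuity is stability. Elsewhere the kernels are
    Lipschitz near [r0] with constants independent of the data and [v] is bounded on their support,
    so the supremum is Lipschitz too. *)
Let X_continuous r0 s0 : 0 <= r0 -> forall e, 0 < e -> exists2 d, 0 < d &
  forall r s, 0 <= r -> `|r - r0| <= d -> `|s - s0| <= d -> `|X r0 s0 - X r s| <= e.
Proof.
rewrite le_eqVlt => /predU1P[<-|r00] e e0.
  have [d d0 Hd] := D_stable e0; exists (d / 2); first exact: divr_gt0.
  move=> r s r0'; rewrite subr0 ger0_norm// => rd _.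
  rewrite X0 sub0r normrN ger0_norm ?X_ge0//; apply: X_le => //; first exact: ltW.
  by move=> rho sigma v Dv _ h _; apply: Hd Dv _; lra.
have [B0 HB0] := D_bounded (4 * r0); pose B := `|B0| + 1.
have B0' : 0 < B by rewrite ltr_pwDr.
have HB rho sigma v : D rho sigma v -> rho <= 4 * r0 -> v <= B.
  move=> Dv h; apply: le_trans (HB0 _ _ _ Dv h) _.
  by rewrite (le_trans (ler_norm _))// lerDl.
have K0 : 0 < B * (8 / r0 + 1) by rewrite mulr_gt0// addr_gt0// divr_gt0.
exists (Num.min (r0 / 2) (e / (B * (8 / r0 + 1)))).
  by rewrite lt_min !divr_gt0.
move=> r s r0'; rewrite !le_min => /andP[rr re] /andP[_ se].
have [rl ru] : r0 / 2 <= r /\ r <= 2 * r0.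
  by move: rr; rewrite ler_distl => /andP[]; lra.
have term rho sigma v : D rho sigma v ->
  `|v * (kr rho r * ks sigma s) - v * (kr rho r0 * ks sigma s0)| <= e.
  move=> Dv; have [rho0 v0] := D_ge0 Dv.
  (* Beyond [4 * r0] both first kernels vanish, because [r <= 2 * r0]. *)
  have [h|h] := leP rho (4 * r0); last first.
    have kr0 x : 0 < x -> x <= 2 * r0 -> kr rho x = 0.
      move=> x0 xr; rewrite /kr clamp_eq0//.
      by apply: mulr_le0_ge0; [lra|rewrite invr_ge0; lra].
    by rewrite !kr0 ?mul0r ?mulr0 ?subrr ?normr0 ?(ltW e0)//; lra.
  have dk : `|kr rho r - kr rho r0| <= 8 / r0 * `|r - r0|.
    apply: le_trans (clamp_dist _ _) (kr_dist r00 rl ru _).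
    by rewrite rho0.
  have ds : `|ks sigma s - ks sigma s0| <= `|s - s0|.
    apply: le_trans (clamp_dist _ _) _.
    by rewrite [X in `|X| <= _](_ : _ = s0 - s) 1?distrC//; ring.
  rewrite -mulrBr normrM ger0_norm//.
  rewrite (_ : _ - _ = (kr rho r - kr rho r0) * ks sigma s
    + kr rho r0 * (ks sigma s - ks sigma s0)); last by ring.
  have dks : `|(kr rho r - kr rho r0) * ks sigma s
    + kr rho r0 * (ks sigma s - ks sigma s0)| <= (8 / r0 + 1) * (e / (B * (8 / r0 + 1))).
    apply: le_trans (ler_normD _ _) _; rewrite !normrM mulrDl mul1r; apply: lerD.
      rewrite [X in _ * X]ger0_norm; last exact: clamp_ge0.
      apply: le_trans (ler_piMr _ (clamp_le1 _)) _ => //.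
      by rewrite (le_trans dk)// ler_wpM2l// divr_ge0// ltW.
    rewrite ger0_norm; last exact: clamp_ge0.
    by apply: le_trans (ler_piMl _ (clamp_le1 _)) _ => //; exact: le_trans se.
  apply: le_trans (ler_pM v0 _ (HB _ _ _ Dv h) dks) _ => //.
  rewrite le_eqVlt; apply/orP; left; apply/eqP; field; rewrite !gt_eqF// addr_gt0//.
rewrite ler_distl lerBlDr; apply/andP; split; apply: X_dist; rewrite ?(ltW r00) ?(ltW e0)// => rho sigma v Dv.
  by have := term _ _ _ Dv; rewrite ler_distl => /andP[_].
by have := term _ _ _ Dv; rewrite distrC ler_distl => /andP[_].
Qed.

Lemma kl_majorant : exists chi : R -> R -> R, class_kl +oo%E chi /\
  forall rho sigma v, D rho sigma v -> v <= chi rho sigma.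
Proof.
have within_X (A : set (R * R)) : A `<=` [set p | 0 <= p.1] ->
    {within A, continuous (fun p : R * R => X p.1 p.2 + p.1 * expR (- p.2))}.
  move=> A0; apply/subspace_continuousP => -[r0 s0] Ars; apply: cvgD; last first.
    apply: cvg_within_filter; apply: cvgM; first exact: cvg_fst.
    by apply: (@continuous_comp _ _ _ (fun p : R * R => - p.2) expR);
      [apply: cvgN; exact: cvg_snd|exact: continuous_expR].
  apply/cvgrPdist_le => e e0 /=; have [d d0 Xd] := X_continuous s0 (A0 _ Ars) e0.
  have [c1 c2] : (fun p : R * R => p.1) @ (r0, s0) --> r0 /\
      (fun p : R * R => p.2) @ (r0, s0) --> s0.
    by split; [exact: cvg_fst|exact: cvg_snd].
  rewrite near_withinE; near=> p => /A0 p0.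
  by apply: Xd => //; rewrite distrC; near: p;
    [move/cvgrPdist_le : c1|move/cvgrPdist_le : c2]; exact.
(* [X] is only nondecreasing in [r]; the added term makes the sum strictly increasing and still
   vanishes at [r = 0] and as [s] tends to infinity. *)
exists (fun r s => X r s + r * expR (- s)); split; last first.
  move=> rho sigma v Dv; have [rho0 _] := D_ge0 Dv.
  by apply: le_trans (X_majorant Dv) _; rewrite lerDl mulr_ge0 ?expR_ge0.
split.
- by apply: within_X => -[r s] [[]].
- move=> s s0; split.
  + apply/subspace_continuousP => r0 [r00 _]; apply: cvgD; last first.
      by apply: cvg_within_filter; apply: cvgM; [exact: id|exact: cvg_cst].
    apply/cvgrPdist_le => e e0; have [d d0 Xd] := X_continuous s r00 e0.
    rewrite near_withinE; near=> r => -[r'0 _]; apply: Xd => //; last by rewrite subrr normr0 ltW.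
  + by move=> r [r0 _]; rewrite addr_ge0 ?X_ge0// mulr_ge0 ?expR_ge0.
  + move=> r r' [r0 _] _ rr'; apply: ler_ltD; first by rewrite X_ndecr// ltW.
    by rewrite ltr_pM2r// expR_gt0.
  + by rewrite X0 mul0r addr0.
- move=> r [r0 _] s s' s0 ss'; rewrite lerD ?X_nincr// ler_wpM2l//.
  by rewrite ler_expR lerN2.
- move=> r [r0 _].
  rewrite [X in _ --> X](_ : _ = 0 + r * 0); last by rewrite mulr0 addr0.
  apply: cvgD; first exact: X_cvg0.
  by apply: cvgM; [exact: cvg_cst|exact: cvgr_expR].
Unshelve. all: by end_near. Qed.

End KLMajorant.

(** * Energy estimates *)

(** The derivative is left as an existential variable filled by the structural rules; [C1_after_eq]
    followed by [ring] or [field] then brings it to the wanted form. *)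
Ltac C1_after_calculus :=
  lazymatch goal with
  | |- C1_after _ (fun t => @?a t + @?b t) _ => eapply C1_afterD; C1_after_calculus
  | |- C1_after _ (fun t => @?a t * @?b t) _ => eapply C1_afterM; C1_after_calculus
  | |- C1_after _ (fun t => @?a t ^+ 2) _ => eapply C1_after_sqr; C1_after_calculus
  | |- C1_after _ (fun t => - @?a t) _ => eapply C1_afterN; C1_after_calculus
  | |- C1_after _ (fun _ => ?c) _ => eapply C1_after_cst
  | |- _ => eassumption
  end.

(** Completing the square. A cross term costs a constant [mu] plus a multiple of [y ^+ 2], the
    latter to be absorbed by an already available negative square. *)
Lemma young_sqr (R : realType) (mu a y C : R) : 0 < mu -> `|a| <= C ->
  a * y <= mu + C ^+ 2 / (4 * mu) * y ^+ 2.
Proof.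
move=> mu0 aC; have C0 : 0 <= C := le_trans (normr_ge0 _) aC.
apply: le_trans (ler_norm _) _; rewrite normrM -(real_normK (num_real y)).
have := normr_ge0 y; move: `|y| => x x0.
apply: le_trans (ler_wpM2r x0 aC) _.
rewrite -subr_ge0 (_ : _ - _ = (2 * mu - C * x) ^+ 2 / (4 * mu)); last by field; rewrite gt_eqF.
by rewrite divr_ge0 ?sqr_ge0// mulr_ge0// ltW.
Qed.

(** * Exponential decay of the forced damped oscillator *)

Section DampedOscillator.
Variables (R : realType) (k3 k4 : R).
Hypotheses (k30 : 0 < k3) (k40 : 0 < k4).

(* The cross term cancels the product [psi * r] in the derivative, which leaves
   [- k4 * r ^+ 2 - k4 * k3 * psi ^+ 2] in the absence of forcing. *)
Definition osc_energy (psi r : R) : R :=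
  (k3 + k4 ^+ 2 / 2) * psi ^+ 2 + k4 * psi * r + r ^+ 2.

Lemma osc_energy_ge psi r : k3 * psi ^+ 2 <= osc_energy psi r /\
  r ^+ 2 <= 2 * osc_energy psi r.
Proof.
rewrite /osc_energy; split; rewrite -subr_ge0.
  rewrite [leRHS](_ : _ = (k4 * psi / 2) ^+ 2 + (k4 * psi / 2 + r) ^+ 2); last by field.
  by rewrite addr_ge0// sqr_ge0.
rewrite [leRHS](_ : _ = 2 * k3 * psi ^+ 2 + (k4 * psi + r) ^+ 2); last by field.
by rewrite addr_ge0 ?sqr_ge0// mulr_ge0 ?sqr_ge0// mulr_ge0// ltW.
Qed.

Lemma osc_energy_ge0 psi r : 0 <= osc_energy psi r.
Proof.
by have [+ _] := osc_energy_ge psi r; apply: le_trans; rewrite mulr_ge0 ?sqr_ge0// ltW.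
Qed.

Lemma osc_energy_le : exists2 c, 0 < c & forall psi r,
  osc_energy psi r <= c * (psi ^+ 2 + r ^+ 2).
Proof.
exists (k3 + k4 ^+ 2 + 2) => [|psi r].
  by rewrite !addr_gt0// exprn_gt0.
rewrite -subr_ge0 /osc_energy.
rewrite [leRHS](_ : _ = (k4 / 2 * psi - r) ^+ 2 + (k4 / 2 * psi) ^+ 2 + 2 * psi ^+ 2 + (k3 + k4 ^+ 2) * r ^+ 2); last by field.
have := ltW k30; have := sqr_ge0 psi; have := sqr_ge0 r; have := sqr_ge0 k4 => *.
by rewrite !addr_ge0 ?sqr_ge0// mulr_ge0// addr_ge0.
Qed.

(** The excess of the energy over the level that the forcing can sustain, multiplied by
    [expR (l * (t - a))], is nonincreasing. *)
Lemma osc_energy_decay : exists l kap : R, [/\ 0 < l, 0 < kap &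
  forall t0 (psi r w : R -> R) a b om,
  C1_after t0 psi r ->
  C1_after t0 r (fun t => - k3 * psi t - k4 * r t + w t) ->
  t0 <= a -> a <= b -> (forall t, a < t -> `|w t| <= om) ->
  osc_energy (psi b) (r b)
    <= expR (- (l * (b - a))) * osc_energy (psi a) (r a) + kap * om ^+ 2].
Proof.
(* The rate [l] makes [l] times the energy at most [k4 / 2 * r ^+ 2 + k4 * k3 / 4 * psi ^+ 2]. The
   two summands of [kap] come from splitting [2 * r * w] and [k4 * psi * w], which use up half of
   each damping term. *)
pose l := k4 * k3 / (4 * (k3 + k4 ^+ 2)); pose kap := 2 / k4 + k4 / (2 * k3).
have k34 : 0 < k3 + k4 ^+ 2 by rewrite addr_gt0// exprn_gt0.
have l0 : 0 < l by rewrite divr_gt0// !mulr_gt0.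
have kap0 : 0 < kap by rewrite addr_gt0// divr_gt0// mulr_gt0.
exists l, (kap / l); split=> //; first exact: divr_gt0.
move=> t0 psi r w a b om Dpsi Dr ta ab wom.
have DE : C1_after t0 (fun t => osc_energy (psi t) (r t))
    (fun t => - k4 * r t ^+ 2 - k4 * k3 * psi t ^+ 2 + (2 * r t + k4 * psi t) * w t).
  rewrite /osc_energy; apply: C1_after_eq; first by C1_after_calculus.
  by move=> t _ /=; field.
have De := C1_after_expR t0 l a.
have := C1_after_nincr (C1_afterM (C1_afterD DE (C1_after_cst t0 (- (kap / l * om ^+ 2)))) De) ta ab.
have lk : l * (k3 + k4 ^+ 2) = k4 * k3 / 4 by rewrite /l; field; rewrite gt_eqF.
have l4 : l * 4 <= k4.
  have -> : l * 4 = k4 * (k3 / (k3 + k4 ^+ 2)) by rewrite /l; field; rewrite gt_eqF.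
  by rewrite ler_piMr ?(ltW k40)// ler_pdivrMr// mul1r lerDl sqr_ge0.
move: lk l4 l0 De; clearbody l => lk l4 l0 De.
rewrite subrr mulr0 expR0 mulr1 => H.
have {H} : (osc_energy (psi b) (r b) - kap / l * om ^+ 2) * expR (l * (b - a))
    <= osc_energy (psi a) (r a) - kap / l * om ^+ 2.
  apply: H => t /andP[at_ _]; 
  rewrite [leLHS](_ : _ = (- k4 * r t ^+ 2 - k4 * k3 * psi t ^+ 2 + (2 * r t + k4 * psi t) * w t
    + l * (osc_energy (psi t) (r t) - kap / l * om ^+ 2)) * expR (l * (t - a))); last by ring.
  rewrite mulr_le0_ge0 ?expR_ge0//.
  have w2 : w t ^+ 2 <= om ^+ 2.
    by rewrite -(ger0_norm (sqr_ge0 (w t))) normrX lerXn2r ?nnegrE ?wom// (le_trans _ (wom _ at_)).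
  have E1 : osc_energy (psi t) (r t) <= 2 * r t ^+ 2 + (k3 + k4 ^+ 2) * psi t ^+ 2.
    rewrite -subr_ge0 /osc_energy.
    rewrite [leRHS](_ : _ = (r t - k4 * psi t / 2) ^+ 2 + (k4 * psi t / 2) ^+ 2); last by field.
    by rewrite addr_ge0// sqr_ge0.
  have E1' : l * osc_energy (psi t) (r t) <= l * 2 * r t ^+ 2 + k4 * k3 / 4 * psi t ^+ 2.
    by rewrite -lk -!mulrA -mulrDr ler_pM2l.
  have E2 : 2 * r t * w t <= k4 / 2 * r t ^+ 2 + 2 / k4 * w t ^+ 2.
    rewrite -subr_ge0 [leRHS](_ : _ = (k4 * r t - 2 * w t) ^+ 2 / (2 * k4)); last by field; rewrite gt_eqF.
    by rewrite divr_ge0 ?sqr_ge0// mulr_ge0// ltW.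
  have E3 : k4 * psi t * w t <= k4 * k3 / 2 * psi t ^+ 2 + k4 / (2 * k3) * w t ^+ 2.
    rewrite -subr_ge0 [leRHS](_ : _ = k4 * (k3 * psi t - w t) ^+ 2 / (2 * k3)); last by field; rewrite gt_eqF.
    by apply: divr_ge0; apply: mulr_ge0; rewrite ?sqr_ge0// ltW.
  have E4 := ler_wpM2r (sqr_ge0 (r t)) l4.
  have E5 := ler_wpM2l (ltW kap0) w2; rewrite [X in X <= _]mulrDl in E5.
  have E6 : 0 <= k4 * k3 * psi t ^+ 2 by rewrite mulr_ge0 ?sqr_ge0 ?(mulr_ge0 (ltW k40) (ltW k30)).
  have -> : l * (osc_energy (psi t) (r t) - kap / l * om ^+ 2)
      = l * osc_energy (psi t) (r t) - kap * om ^+ 2 by field; rewrite gt_eqF.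
  lra.
rewrite -ler_pdivlMr ?expR_gt0// -expRN mulrC => H.
have := lexx (kap / l * om ^+ 2); have := expR_ge0 (- (l * (b - a))).
have : 0 <= kap / l * om ^+ 2 by rewrite mulr_ge0 ?sqr_ge0// divr_ge0// ltW.
nra.
Qed.

End DampedOscillator.

(** * Uniform attractivity *)

(** Only the existence of bounds on the Matrosov coefficients matters; this property is stable under
    the ring operations, so no explicit constant has to be computed. *)
Definition bounded_over (R : realType) (T : Type) (A : set T) (h : T -> R) : Prop :=
  exists2 C, 0 <= C & forall p, A p -> `|h p| <= C.

Section BoundedOver.
Variables (R : realType) (T : Type) (A : set T).
Implicit Types g h : T -> R.

Lemma bounded_over_cst c : bounded_over A (fun=> c : R).
Proof. by exists `|c|. Qed.

Lemma bounded_overN h : bounded_over A h -> bounded_over A (fun p => - h p).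
Proof. by move=> [C C0 hC]; exists C => // p Ap; rewrite normrN; exact: hC. Qed.

Lemma bounded_overD g h : bounded_over A g -> bounded_over A h ->
  bounded_over A (fun p => g p + h p).
Proof.
move=> [C C0 gC] [D D0 hD]; exists (C + D) => [|p Ap]; first exact: addr_ge0.
by apply: le_trans (ler_normD _ _) _; apply: lerD; [exact: gC|exact: hD].
Qed.

Lemma bounded_overM g h : bounded_over A g -> bounded_over A h ->
  bounded_over A (fun p => g p * h p).
Proof.
move=> [C C0 gC] [D D0 hD]; exists (C * D) => [|p Ap]; first exact: mulr_ge0.
by rewrite normrM ler_pM//; [exact: gC|exact: hD].
Qed.

Lemma bounded_overX g n : bounded_over A g -> bounded_over A (fun p => g p ^+ n).
Proof.
move=> bg; elim: n => [|n IH].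
  by exists 1 => // p _; rewrite expr0 normr1.
have [C C0 gC] := bounded_overM bg IH.
by exists C => // p Ap; rewrite exprS; exact: gC.
Qed.

Lemma bounded_over_norm h : bounded_over A h -> bounded_over A (fun p => `|h p|).
Proof. by move=> [C C0 hC]; exists C => // p Ap; rewrite normr_id; exact: hC. Qed.

End BoundedOver.

Ltac bounded_over_calculus :=
  lazymatch goal with
  | |- bounded_over _ (fun p => @?a p + @?b p) => apply (@bounded_overD _ _ _ a b); bounded_over_calculus
  | |- bounded_over _ (fun p => @?a p * @?b p) => apply (@bounded_overM _ _ _ a b); bounded_over_calculus
  | |- bounded_over _ (fun p => `|@?a p|) => apply (@bounded_over_norm _ _ _ a); bounded_over_calculus
  | |- bounded_over _ (fun p => - @?a p) => apply (@bounded_overN _ _ _ a); bounded_over_calculus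
  | |- bounded_over _ (fun p => @?a p ^+ ?n) => apply (@bounded_overX _ _ _ a n); bounded_over_calculus
  | |- bounded_over _ (fun _ => ?c) => apply bounded_over_cst
  | |- _ => assumption
  end.

(** * Nested Matrosov functions *)

Section Attractivity.
Variables (R : realType) (k1 k2 k3 k4 : R) (f df : R -> R).
Hypotheses (k10 : 0 < k1) (k20 : 0 < k2).
Hypothesis Df : forall y : R, is_derive y 1 f (df y).
Hypothesis cdf : continuous df.
Hypothesis f_neq0 : forall y, y != 0 -> f y != 0.

Let cf : continuous f.
Proof. by move=> y; apply: differentiable_continuous; apply/derivable1_diffP; case: (Df y). Qed.

Definition solution (t0 : R) (z psi u r : R -> R) : Prop :=
  [/\ C1_after t0 z (fun t => - (u t * r t)),
      C1_after t0 psi r,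
      C1_after t0 u (fun t => k1 * z t * r t - k2 * u t)
    & C1_after t0 r (fun t => - k3 * psi t - k4 * r t + f (z t) * cos t)].

Definition zu_energy (z u : R) : R := k1 * z ^+ 2 + u ^+ 2.

(** The weight [k1] makes the coupling terms in [z * u * r] cancel, leaving only the damping of
    [u]. *)
Lemma C1_after_zu_energy t0 z psi u r : solution t0 z psi u r ->
  C1_after t0 (fun t => zu_energy (z t) (u t)) (fun t => - (2 * k2 * u t ^+ 2)).
Proof.
move=> [Dz Dpsi Du Dr]; rewrite /zu_energy; apply: C1_after_eq.
  by C1_after_calculus.
by move=> t _ /=; ring.
Qed.

Lemma zu_energy_nincr t0 z psi u r a b : solution t0 z psi u r ->
  t0 <= a -> a <= b -> zu_energy (z b) (u b) <= zu_energy (z a) (u a).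
Proof.
move=> /C1_after_zu_energy DV ta ab; apply: C1_after_nincr DV ta ab _ => t _.
by rewrite oppr_le0 mulr_ge0 ?sqr_ge0// mulr_ge0// ltW.
Qed.

Let q (t z psi : R) : R := - k3 * psi + f z * cos t.
(** The negative squares arise because [u'] contains [k1 * z * r] (for [P2]) and [r'] is
    [q - k4 * r] (for [P3]). *)
Let P2 (z u r : R) : R := - (z * r * u).
Let P3 (t z psi r : R) : R := - (z ^+ 2 * r * q t z psi).
(** Since [q'] contains [- f z * sin t], the first term yields
    [- 2 * z ^+ 2 * f z ^+ 2 * sin t ^+ 2], which degenerates where [sin t = 0]. The second yields
    [- z ^+ 2 * f z ^+ 2 * (cos t ^+ 2 - sin t ^+ 2)], and the sum is free of [t]. *)
Let P4 (t z psi : R) : R := 2 * z ^+ 2 * q t z psi * f z * sin t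
  - z ^+ 2 * f z ^+ 2 * sin t * cos t.

(* [A_i], [B_i], [C_i] are the coefficients of [u], [z * r] and [z * q] in the
   derivative of [P_i]; [dq] is the derivative of q. *)
Let A2 (t z psi u r : R) : R := u * r ^+ 2 - z * q t z psi + k4 * z * r + k2 * z * r.
Let dq (t z u r : R) : R := - k3 * r - df z * u * r * cos t - f z * sin t.
Let A3 (t z psi r : R) : R := 2 * z * r ^+ 2 * q t z psi.
Let B3 (t z psi u r : R) : R := k4 * z * q t z psi - z * dq t z u r.
Let A4 (t z psi r : R) : R := - 4 * z * r * q t z psi * f z * sin t
  + 2 * z * r * f z ^+ 2 * sin t * cos t
  - 2 * z ^+ 2 * f z * sin t * df z * r * cos t
  - 2 * z ^+ 2 * q t z psi * df z * r * sin t
  + 2 * z ^+ 2 * f z * df z * r * sin t * cos t.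
Let B4 (t z : R) : R := - 2 * k3 * z * f z * sin t.
Let C4 (t z : R) : R := 2 * z * f z * cos t.

Section Derivatives.
Variables (t0 : R) (z psi u r : R -> R).
Hypothesis sol : solution t0 z psi u r.

Let Dz : C1_after t0 z (fun t => - (u t * r t)). Proof. by case: sol. Qed.
Let Dpsi : C1_after t0 psi r. Proof. by case: sol. Qed.
Let Du : C1_after t0 u (fun t => k1 * z t * r t - k2 * u t). Proof. by case: sol. Qed.
Let Dr : C1_after t0 r (fun t => - k3 * psi t - k4 * r t + f (z t) * cos t).
Proof. by case: sol. Qed.
Let Df_z : C1_after t0 (fun t => f (z t)) (fun t => df (z t) * - (u t * r t)).
Proof. exact: C1_after_comp Df Dz. Qed.
Let Dcos : C1_after t0 (@cos R) (fun t => - sin t).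
Proof. by split=> [|t _]; [exact: continuous_cos|exact: is_derive_cos]. Qed.
Let Dsin : C1_after t0 (@sin R) (@cos R).
Proof. by split=> [|t _]; [exact: continuous_sin|exact: is_derive_sin]. Qed.

Let DP2 : C1_after t0 (fun t => P2 (z t) (u t) (r t))
  (fun t => - k1 * (z t * r t) ^+ 2 + u t * A2 t (z t) (psi t) (u t) (r t)).
Proof.
rewrite /P2 /A2 /q; apply: C1_after_eq; first by C1_after_calculus.
by move=> t _ /=; ring.
Qed.

Let DP3 : C1_after t0 (fun t => P3 t (z t) (psi t) (r t))
  (fun t => - (z t * q t (z t) (psi t)) ^+ 2 + u t * A3 t (z t) (psi t) (r t)
    + z t * r t * B3 t (z t) (psi t) (u t) (r t)).
Proof.
rewrite /P3 /A3 /B3 /dq /q; apply: C1_after_eq; first by C1_after_calculus.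
by move=> t _ /=; ring.
Qed.

Let DP4 : C1_after t0 (fun t => P4 t (z t) (psi t))
  (fun t => - (z t ^+ 2 * f (z t) ^+ 2) + u t * A4 t (z t) (psi t) (r t)
    + z t * r t * B4 t (z t) + z t * q t (z t) (psi t) * C4 t (z t)).
Proof.
rewrite /P4 /A4 /B4 /C4 /q; apply: C1_after_eq; first by C1_after_calculus.
(* Inserting [cos t ^+ 2 + sin t ^+ 2] turns the claim into a polynomial identity. *)
move=> t _ /=; rewrite [X in _ = - X + _ + _ + _](_ : _ =
  z t ^+ 2 * f (z t) ^+ 2 * (cos t ^+ 2 + sin t ^+ 2)); last by rewrite cos2Dsin2 mulr1.
by ring.
Qed.


(** The derivative is arranged so that each cross term is followed by the negative square meant to
    absorb it. The factor of [z * r] involves only [K3], and that of [u] only [K3] and [K2], so the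
    constants can be chosen in the order [K3], [K2], [K1]. *)
Lemma C1_after_matrosov K1 K2 K3 :
  C1_after t0 (fun t => P4 t (z t) (psi t) + K3 * P3 t (z t) (psi t) (r t)
      + K2 * P2 (z t) (u t) (r t) + K1 * zu_energy (z t) (u t))
    (fun t => - (z t ^+ 2 * f (z t) ^+ 2)
      + z t * q t (z t) (psi t) * C4 t (z t) - K3 * (z t * q t (z t) (psi t)) ^+ 2
      + z t * r t * (B4 t (z t) + K3 * B3 t (z t) (psi t) (u t) (r t))
      - K2 * k1 * (z t * r t) ^+ 2
      + u t * (A4 t (z t) (psi t) (r t) + K3 * A3 t (z t) (psi t) (r t)
        + K2 * A2 t (z t) (psi t) (u t) (r t))
      - 2 * K1 * k2 * u t ^+ 2).
Proof.
have DV := C1_after_zu_energy sol.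
have := DP2; have := DP3; have := DP4 => H4 H3 H2.
apply: C1_after_eq; first by C1_after_calculus.
by move=> t _ /=; ring.
Qed.

End Derivatives.

(** A point is [(t, z, psi, u, r)]. Time is unrestricted, which makes the resulting bounds uniform
    in the initial time. *)
Let box B := [set p : R * R * R * R * R | [/\ `|p.1.1.1.2| <= B, `|p.1.1.2| <= B,
  `|p.1.2| <= B & `|p.2| <= B]].

Let box_bounds B : [/\ bounded_over (box B) (fun p => p.1.1.1.2),
  bounded_over (box B) (fun p => p.1.1.2), bounded_over (box B) (fun p => p.1.2),
  bounded_over (box B) (fun p => p.2) &
  [/\ bounded_over (box B) (fun p => cos p.1.1.1.1),
  bounded_over (box B) (fun p => sin p.1.1.1.1),
  bounded_over (box B) (fun p => f p.1.1.1.2) &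
  bounded_over (box B) (fun p => df p.1.1.1.2)]].
Proof.
have coord (h : R * R * R * R * R -> R) :
    (forall p, box B p -> `|h p| <= B) -> bounded_over (box B) h.
  by move=> hB; exists `|B| => // p /hB/le_trans; apply; exact: ler_norm.
split; [by apply: coord => p []..|split].
- by exists 1 => // p _; rewrite ler_norml cos_geN1 cos_le1.
- by exists 1 => // p _; rewrite ler_norml sin_geN1 sin_le1.
- by have [C C0 fC] := continuous_norm_le cf B; exists C => // p [h _ _ _]; exact: fC.
- by have [C C0 fC] := continuous_norm_le cdf B; exists C => // p [h _ _ _]; exact: fC.
Qed.

Let matrosov_coeff_bound B : exists2 C, 0 <= C & forall t z psi u r : R,
  `|z| <= B -> `|psi| <= B -> `|u| <= B -> `|r| <= B ->
  [/\ `|A2 t z psi u r| <= C, `|A3 t z psi r| <= C, `|B3 t z psi u r| <= C &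
   [/\ `|A4 t z psi r| <= C, `|B4 t z| <= C & `|C4 t z| <= C]].
Proof.
have [bz bpsi bu br [bc bs bf bdf]] := box_bounds B.
(* Bounding the sum of the absolute values gives one constant for all six coefficients. *)
have [C C0 HC] : bounded_over (box B) (fun p =>
    `|A2 p.1.1.1.1 p.1.1.1.2 p.1.1.2 p.1.2 p.2| + `|A3 p.1.1.1.1 p.1.1.1.2 p.1.1.2 p.2|
    + `|B3 p.1.1.1.1 p.1.1.1.2 p.1.1.2 p.1.2 p.2| + `|A4 p.1.1.1.1 p.1.1.1.2 p.1.1.2 p.2|
    + `|B4 p.1.1.1.1 p.1.1.1.2| + `|C4 p.1.1.1.1 p.1.1.1.2|).
  rewrite /A2 /A3 /B3 /A4 /B4 /C4 /dq /q; bounded_over_calculus.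
exists C => // t z psi u r hz hpsi hu hr.
have /= := HC (t, z, psi, u, r) (And4 hz hpsi hu hr).
rewrite ger0_norm ?addr_ge0// => hC.
have := normr_ge0 (A2 t z psi u r); have := normr_ge0 (A3 t z psi r).
have := normr_ge0 (B3 t z psi u r); have := normr_ge0 (A4 t z psi r).
have := normr_ge0 (B4 t z); have := normr_ge0 (C4 t z).
move: hC; move: (`|A2 _ _ _ _ _|) (`|A3 _ _ _ _|) (`|B3 _ _ _ _ _|) (`|A4 _ _ _ _|) (`|B4 _ _|) (`|C4 _ _|).
by move=> *; split; [lra|lra|lra|split; lra].
Qed.

Let matrosov_bound B K1 K2 K3 : exists2 C, 0 <= C & forall t z psi u r : R,
  `|z| <= B -> `|psi| <= B -> `|u| <= B -> `|r| <= B ->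
  `|P4 t z psi + K3 * P3 t z psi r + K2 * P2 z u r + K1 * zu_energy z u| <= C.
Proof.
have [bz bpsi bu br [bc bs bf bdf]] := box_bounds B.
have [C C0 HC] : bounded_over (box B) (fun p => P4 p.1.1.1.1 p.1.1.1.2 p.1.1.2
    + K3 * P3 p.1.1.1.1 p.1.1.1.2 p.1.1.2 p.2 + K2 * P2 p.1.1.1.2 p.1.2 p.2
    + K1 * zu_energy p.1.1.1.2 p.1.2).
  rewrite /P4 /P3 /P2 /zu_energy /q; bounded_over_calculus.
exists C => // t z psi u r hz hpsi hu hr.
exact: (HC (t, z, psi, u, r) (And4 hz hpsi hu hr)).
Qed.

(** If [z] is small then [k1 * z ^+ 2 < d / 2], so the energy level forces [d / 2 <= u ^+ 2]; the
    weight [2 * m / d] converts this into [m]. *)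
Let zu_energy_split m z u d : m <= z ^+ 2 * f z ^+ 2 \/ z ^+ 2 < d / (2 * k1) ->
  d < zu_energy z u -> 0 < d -> 0 <= m ->
  m <= z ^+ 2 * f z ^+ 2 + 2 * m / d * u ^+ 2.
Proof.
move=> zd dV d0 m0; case: zd => [mz|zd].
  by rewrite (le_trans mz)// lerDl mulr_ge0 ?sqr_ge0// divr_ge0 ?mulr_ge0// ltW.
have u2 : d / 2 <= u ^+ 2.
  rewrite ltr_pdivlMr ?mulr_gt0// in zd; move: dV; rewrite /zu_energy; lra.
rewrite -[leLHS]add0r; apply: lerD; first by rewrite mulr_ge0 ?sqr_ge0.
have := ler_wpM2l (divr_ge0 (mulr_ge0 (ler0n _ 2) m0) (ltW d0)) u2.
by have -> : 2 * m / d * (d / 2) = m by field; rewrite gt_eqF.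
Qed.

Lemma zu_energy_attractive B d : 0 < d -> exists2 T, 0 <= T &
  forall t0 (z psi u r : R -> R), solution t0 z psi u r ->
  (forall t, t0 <= t -> [/\ `|z t| <= B, `|psi t| <= B, `|u t| <= B & `|r t| <= B]) ->
  exists2 t, t0 <= t <= t0 + T & zu_energy (z t) (u t) <= d.
Proof.
move=> d0.
have [m m0 fm] := continuous_sqr_ge cf B (divr_gt0 d0 (mulr_gt0 (ltr0Sn _ 1) k10)) f_neq0.
(* Three uses of [young_sqr] cost [3 * mu] out of [m = 4 * mu], which leaves a decrease at rate
   [mu]. *)
pose mu := m / 4; have mu0 : 0 < mu by rewrite divr_gt0.
have [C C0 HC] := matrosov_coeff_bound B.
(* [K3], [K2] and [K1] absorb in turn the squares of [z * q], [z * r] and [u] produced by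
   [young_sqr]; [K1] also supplies the [2 * m / d] required by [zu_energy_split]. *)
pose K3 := C ^+ 2 / (4 * mu).
have K30 : 0 <= K3 by rewrite divr_ge0 ?sqr_ge0// mulr_ge0// ltW.
pose K2 := (C + K3 * C) ^+ 2 / (4 * mu) / k1.
have K20 : 0 <= K2 by apply: divr_ge0; [rewrite divr_ge0 ?sqr_ge0// mulr_ge0// ltW|exact: ltW].
pose K1 := ((C + K3 * C + K2 * C) ^+ 2 / (4 * mu) + 2 * m / d) / (2 * k2).
have [D D0 HD] := matrosov_bound B K1 K2 K3.
(* A decrease at rate [mu] over this time amounts to [2 * D + mu], more than a function bounded by
   [D] in absolute value allows. *)
exists (2 * D / mu + 1) => [|t0 z psi u r sol xB].
  by rewrite addr_ge0// divr_ge0 ?mulr_ge0// ltW.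
set T := 2 * D / mu + 1.
have T0 : 0 < T by rewrite ltr_wpDl// divr_ge0 ?mulr_ge0// ltW.
apply: contrapT => noT.
have dV t : t0 <= t <= t0 + T -> d < zu_energy (z t) (u t).
  by move=> tT; rewrite ltNge; apply/negP => Vd; apply: noT; exists t.
have H := C1_after_matrosov sol K1 K2 K3.
have {H} := C1_after_nincr (C1_afterD H (C1_afterM (C1_after_cst t0 mu) (C1_after_id t0)))
  (lexx t0) (_ : t0 <= t0 + T).
rewrite lerDl (ltW T0) => /(_ isT) H.
have {H} Psi_decr : P4 (t0 + T) (z (t0 + T)) (psi (t0 + T))
    + K3 * P3 (t0 + T) (z (t0 + T)) (psi (t0 + T)) (r (t0 + T))
    + K2 * P2 (z (t0 + T)) (u (t0 + T)) (r (t0 + T))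
    + K1 * zu_energy (z (t0 + T)) (u (t0 + T)) + mu * (t0 + T) <=
    P4 t0 (z t0) (psi t0) + K3 * P3 t0 (z t0) (psi t0) (r t0)
    + K2 * P2 (z t0) (u t0) (r t0) + K1 * zu_energy (z t0) (u t0) + mu * t0.
  apply: H => t /andP[tt tT]; rewrite mul0r add0r mulr1.
  have [hz hpsi hu hr] := xB _ (ltW tt).
  have [hA2 hA3 hB3 [hA4 hB4 hC4]] := HC t _ _ _ _ hz hpsi hu hr.
  have E1 := young_sqr (z t * q t (z t) (psi t)) mu0 hC4.
  have hB : `|B4 t (z t) + K3 * B3 t (z t) (psi t) (u t) (r t)| <= C + K3 * C.
    apply: le_trans (ler_normD _ _) _; rewrite lerD// normrM ger0_norm//.
    by rewrite ler_wpM2l.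
  have E2 := young_sqr (z t * r t) mu0 hB.
  have hA : `|A4 t (z t) (psi t) (r t) + K3 * A3 t (z t) (psi t) (r t)
      + K2 * A2 t (z t) (psi t) (u t) (r t)| <= C + K3 * C + K2 * C.
    apply: le_trans (ler_normD _ _) _; apply: lerD.
      apply: le_trans (ler_normD _ _) _; rewrite lerD// normrM ger0_norm//.
      by rewrite ler_wpM2l.
    by rewrite normrM ger0_norm// ler_wpM2l.
  have E3 := young_sqr (u t) mu0 hA.
  have E4 : m <= z t ^+ 2 * f (z t) ^+ 2 + 2 * m / d * u t ^+ 2.
    apply: zu_energy_split => //; last exact: ltW.
      by have [h|h] := leP (d / (2 * k1)) (z t ^+ 2); [left; exact: fm|right].
    by apply: dV; rewrite !ltW.
  have K2E : K2 * k1 = (C + K3 * C) ^+ 2 / (4 * mu) by rewrite /K2 divfK// gt_eqF.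
  have K1E : 2 * K1 * k2 = (C + K3 * C + K2 * C) ^+ 2 / (4 * mu) + 2 * m / d.
    by rewrite /K1; move: (_ + 2 * m / d) => X; field; rewrite gt_eqF.
  rewrite K2E K1E; have mE : m = 4 * mu by rewrite /mu; field.
  rewrite -/K3 in E1; set a2 := (C + K3 * C) ^+ 2 / (4 * mu) in E2 *.
  set a1 := (C + K3 * C + K2 * C) ^+ 2 / (4 * mu) in E3 *.
  lra.
have [hz hpsi hu hr] := xB _ (lexx t0).
have := HD t0 _ _ _ _ hz hpsi hu hr; rewrite ler_norml => /andP[_ D1].
have := xB (t0 + T); rewrite lerDl (ltW T0) => /(_ isT)[hz' hpsi' hu' hr'].
have := HD (t0 + T) _ _ _ _ hz' hpsi' hu' hr'; rewrite ler_norml => /andP[D2 _].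
have muT : mu * T = 2 * D + mu by rewrite /T; field; rewrite gt_eqF.
lra.
Qed.

End Attractivity.

(** * Uniform estimates for all solutions *)

Section UniformEstimates.
Variables (R : realType) (k1 k2 k3 k4 : R) (f df : R -> R).
Hypotheses (k10 : 0 < k1) (k20 : 0 < k2) (k30 : 0 < k3) (k40 : 0 < k4).
Hypothesis Df : forall y : R, is_derive y 1 f (df y).
Hypothesis cdf : continuous df.
Hypothesis f0 : forall y, f y = 0 <-> y = 0.

Let cf : continuous f.
Proof. by move=> y; apply: differentiable_continuous; apply/derivable1_diffP; case: (Df y). Qed.

Let f_neq0 y : y != 0 -> f y != 0.
Proof. by move=> y0; apply/eqP => /f0 y0'; rewrite y0' eqxx in y0. Qed.

Notation is_solution := (solution k1 k2 k3 k4 f).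

Definition sqnorm4 (z psi u r : R) : R := z ^+ 2 + psi ^+ 2 + u ^+ 2 + r ^+ 2.

Let norm_le_1Dsqr (x : R) : `|x| <= 1 + x ^+ 2.
Proof. by rewrite -(real_normK (num_real x)); have := sqr_ge0 (`|x| - 1); have := sqr_ge0 `|x|; lra. Qed.

Let zu_energy_le z psi u r : zu_energy k1 z u <= (k1 + 1) * sqnorm4 z psi u r.
Proof.
rewrite /zu_energy /sqnorm4.
have := sqr_ge0 z; have := sqr_ge0 psi; have := sqr_ge0 u; have := sqr_ge0 r.
move: (z ^+ 2) (psi ^+ 2) (u ^+ 2) (r ^+ 2) => a b c d d0 c0 b0 a0.
have := mulr_ge0 (ltW k10) b0; have := mulr_ge0 (ltW k10) c0; have := mulr_ge0 (ltW k10) d0.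
lra.
Qed.

Let zu_energy_ge0 z u : 0 <= zu_energy k1 z u.
Proof. by rewrite addr_ge0 ?sqr_ge0// mulr_ge0 ?sqr_ge0// ltW. Qed.

(** [z] stays in the sublevel set of [zu_energy] reached at time [a], so bounding [f] there bounds
    the forcing afterwards. Starting at [a = t0] gives boundedness and stability; starting once
    [zu_energy] is small gives attractivity. *)
Let energy_estimate : exists c l : R, [/\ 0 < c, 0 < l &
  forall t0 (z psi u r : R -> R) a b om, is_solution t0 z psi u r -> t0 <= a -> a <= b ->
  (forall y, k1 * y ^+ 2 <= zu_energy k1 (z a) (u a) -> `|f y| <= om) ->
  sqnorm4 (z b) (psi b) (u b) (r b) <= c * (zu_energy k1 (z a) (u a)
    + expR (- (l * (b - a))) * sqnorm4 (z a) (psi a) (u a) (r a) + om ^+ 2)].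
Proof.
have [l [kap [l0 kap0 decay]]] := osc_energy_decay k30 k40.
have [c0 c00 Wle] := osc_energy_le k30 k40.
pose cW := k3^-1 + 2; pose cV := k1^-1 + 1.
have cW0 : 0 < cW by rewrite addr_gt0// invr_gt0.
have cV0 : 0 < cV by rewrite addr_gt0// invr_gt0.
exists (cV + cW * c0 + cW * kap), l; split=> //.
  by rewrite addr_gt0 ?mulr_gt0// addr_gt0 ?mulr_gt0.
move=> t0 z psi u r a b om sol ta ab fom.
have [Dz Dpsi Du Dr] := sol.
have om_f t : a < t -> `|f (z t) * cos t| <= om.
  move=> at_; rewrite normrM -[leRHS]mulr1 ler_pM//; last by rewrite ler_norml cos_geN1 cos_le1.
  apply: fom; apply: le_trans (zu_energy_nincr k20 sol ta (ltW at_)).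
  by rewrite lerDl sqr_ge0.
have Wb := decay _ _ _ _ _ _ _ Dpsi Dr ta ab om_f.
have Vb := zu_energy_nincr k20 sol ta ab.
have [Wpsi Wr] := osc_energy_ge k4 k30 (psi b) (r b).
set e := expR _ in Wb *; have e0 : 0 <= e by exact: expR_ge0.
set Va := zu_energy k1 (z a) (u a) in Vb *; have Va0 : 0 <= Va by exact: zu_energy_ge0.
set Na := sqnorm4 (z a) (psi a) (u a) (r a).
have Na0 : 0 <= Na by rewrite !addr_ge0// sqr_ge0.
have om0 := sqr_ge0 om.
have WN : osc_energy k3 k4 (psi a) (r a) <= c0 * Na.
  apply: le_trans (Wle _ _) _; rewrite ler_pM2l// /Na /sqnorm4.
  have := sqr_ge0 (z a); have := sqr_ge0 (u a); lra.
have {Wb WN} Wb : osc_energy k3 k4 (psi b) (r b) <= c0 * (e * Na) + kap * om ^+ 2.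
  by apply: le_trans Wb _; rewrite lerD2r mulrCA ler_wpM2l.
have psir : psi b ^+ 2 + r b ^+ 2 <= cW * osc_energy k3 k4 (psi b) (r b).
  rewrite mulrDl lerD// ler_pdivlMl//.
have zu : z b ^+ 2 + u b ^+ 2 <= cV * Va.
  apply: le_trans (_ : _ <= cV * zu_energy k1 (z b) (u b)) _; last by rewrite ler_pM2l.
  rewrite mulrDl mul1r lerD//; first by rewrite ler_pdivlMl// lerDl sqr_ge0.
  by rewrite lerDr mulr_ge0 ?sqr_ge0// ltW.
have {}Wb := ler_wpM2l (ltW cW0) Wb.
have eN := mulr_ge0 e0 Na0.
have H1 := mulr_ge0 (ltW (mulr_gt0 cW0 c00)) Va0.
have H2 := mulr_ge0 (ltW (mulr_gt0 cW0 kap0)) Va0.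
have H3 := mulr_ge0 (ltW (mulr_gt0 cW0 c00)) om0.
have H4 := mulr_ge0 (ltW (mulr_gt0 cW0 kap0)) eN.
have H5 := mulr_ge0 (ltW cV0) eN.
have H6 := mulr_ge0 (ltW cV0) om0.
rewrite /sqnorm4.
move: psir zu Wb H1 H2 H3 H4 H5 H6; move: (e * Na) (om ^+ 2) (z b ^+ 2) (psi b ^+ 2) (u b ^+ 2) (r b ^+ 2) => *.
lra.
Qed.

Let f_small e : 0 < e -> exists2 d, 0 < d & forall y, k1 * y ^+ 2 <= d -> `|f y| <= e.
Proof.
move=> e0; have /cvgrPdist_le/(_ e e0) : f @ (0 : R) --> f 0 by exact: cf.
rewrite (f0 0).2// => /nbhs_ballP[d /= d0 Hd].
exists (k1 * (d / 2) ^+ 2) => [|y]; first by rewrite mulr_gt0// exprn_gt0// divr_gt0.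
rewrite ler_pM2l// => yd; have := Hd y; rewrite sub0r normrN; apply.
rewrite -ball_normE/= sub0r normrN; apply: (@le_lt_trans _ _ (d / 2)).
  have d2 : 0 <= d / 2 by rewrite divr_ge0// ltW.
  by rewrite -ler_sqr ?nnegrE// real_normK ?num_real.
by rewrite ltr_pdivrMr// ltr_pMr// ltr1n.
Qed.

Lemma solution_bounded M : exists B, forall t0 (z psi u r : R -> R),
  is_solution t0 z psi u r -> sqnorm4 (z t0) (psi t0) (u t0) (r t0) <= M ->
  forall t, t0 <= t -> sqnorm4 (z t) (psi t) (u t) (r t) <= B.
Proof.
have [c [l [c0 l0 est]]] := energy_estimate.
(* The radius comes from [|y| <= 1 + y ^+ 2] and [k1 * y ^+ 2 <= (k1 + 1) * M]. *)
have [C C0 HC] := continuous_norm_le cf (1 + (k1 + 1) * M / k1).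
exists (c * ((k1 + 1) * M + M + C ^+ 2)) => t0 z psi u r sol NM t tt.
have VM : zu_energy k1 (z t0) (u t0) <= (k1 + 1) * M.
  by apply: le_trans (zu_energy_le _ (psi t0) _ (r t0)) _; rewrite ler_pM2l// addr_gt0.
apply: le_trans (est _ _ _ _ _ _ _ C sol (lexx t0) tt _) _.
  move=> y yV; apply: HC; apply: le_trans (norm_le_1Dsqr y) _.
  by rewrite lerD2l ler_pdivlMr// mulrC (le_trans yV).
rewrite ler_pM2l// lerD2r lerD//; apply: le_trans (_ : _ <= 1 * M) _; last by rewrite mul1r.
apply: ler_pM => //.
  by rewrite !addr_ge0// sqr_ge0.
by rewrite -expR0 ler_expR oppr_le0 mulr_ge0 ?subr_ge0// ltW.
Qed.

Lemma solution_stable e : 0 < e -> exists2 d, 0 < d & forall t0 (z psi u r : R -> R),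
  is_solution t0 z psi u r -> sqnorm4 (z t0) (psi t0) (u t0) (r t0) <= d ->
  forall t, t0 <= t -> sqnorm4 (z t) (psi t) (u t) (r t) <= e.
Proof.
move=> e0; have [c [l [c0 l0 est]]] := energy_estimate.
(* The cap at 1 gives [om ^+ 2 <= om], hence [c * om ^+ 2 <= e / 2]. *)
pose om := Num.min 1 (e / c / 2).
have om0 : 0 < om by rewrite lt_min ltr01 !divr_gt0.
have om2 : c * om ^+ 2 <= e / 2.
  rewrite mulrC -ler_pdivlMr// mulrAC (le_trans (_ : _ <= om))//; last by rewrite ge_min lexx orbT.
  by rewrite expr2 ler_piMl// ?ge_min ?lexx// ltW.
have [d d0 Hd] := f_small om0.
have k11 : 0 < k1 + 1 by rewrite addr_gt0.
have k12 : 0 < k1 + 2 by rewrite addr_gt0.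
(* The first bound keeps [z] where [|f z| <= om]; the second makes the energy and norm terms
   together at most [e / 2], as their sum is at most [k1 + 2] times the initial squared norm. *)
exists (Num.min (d / (k1 + 1)) (e / (2 * c * (k1 + 2)))).
  by rewrite lt_min !divr_gt0// !mulr_gt0.
move=> t0 z psi u r sol; rewrite le_min => /andP[Nd Ne] t tt.
have VN := zu_energy_le (z t0) (psi t0) (u t0) (r t0).
apply: le_trans (est _ _ _ _ _ _ _ om sol (lexx t0) tt _) _.
  move=> y yV; apply: Hd; apply: le_trans yV (le_trans VN _).
  by rewrite mulrC -ler_pdivlMr.
rewrite ler_pdivlMr ?mulr_gt0// in Ne.
have : expR (- (l * (t - t0))) * sqnorm4 (z t0) (psi t0) (u t0) (r t0) <=
    sqnorm4 (z t0) (psi t0) (u t0) (r t0).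
  apply: ler_piMl; first by rewrite !addr_ge0// sqr_ge0.
  by rewrite -expR0 ler_expR oppr_le0 mulr_ge0 ?subr_ge0// ltW.
move: VN Ne om2; set N := sqnorm4 _ _ _ _; move: (expR _ * N) (zu_energy k1 _ _) (om ^+ 2) => x V o VN Ne om2 xN.
have := ler_wpM2l (ltW c0) (lerD VN xN).
lra.
Qed.

Let expR_decay (l X Y : R) : 0 < l -> 0 <= X -> 0 < Y ->
  exists2 T, 0 <= T & forall s, T <= s -> expR (- (l * s)) * X <= Y.
Proof.
move=> l0 X0 Y0; exists (X / Y / l) => [|s Ts]; first by rewrite !divr_ge0// ltW.
rewrite expRN mulrC ler_pdivrMr ?expR_gt0// mulrC -ler_pdivrMr//.
apply: le_trans (expR_ge1Dx _); rewrite -[leLHS]add0r lerD//.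
by rewrite [l * s]mulrC -ler_pdivrMr.
Qed.

Lemma solution_attractive M e : 0 < e -> exists T, forall t0 (z psi u r : R -> R),
  is_solution t0 z psi u r -> sqnorm4 (z t0) (psi t0) (u t0) (r t0) <= M ->
  forall t, t0 + T <= t -> sqnorm4 (z t) (psi t) (u t) (r t) <= e.
Proof.
move=> e0; have [c [l [c0 l0 est]]] := energy_estimate.
have [B HB] := solution_bounded M.
(* Each of the three terms of the energy estimate is made at most [e / 3]: the forcing by [om],
   [zu_energy] by [d] after a time [T1], and the exponential by a further time [T2]. *)
pose om := Num.min 1 (e / c / 3).
have om0 : 0 < om by rewrite lt_min ltr01 !divr_gt0.
have om2 : c * om ^+ 2 <= e / 3.
  rewrite mulrC -ler_pdivlMr// mulrAC (le_trans (_ : _ <= om))//; last by rewrite ge_min lexx orbT.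
  by rewrite expr2 ler_piMl// ?ge_min ?lexx// ltW.
have [d1 d10 Hd] := f_small om0.
pose d := Num.min d1 (e / c / 3).
have d0 : 0 < d by rewrite lt_min d10 !divr_gt0.
have cd : c * d <= e / 3.
  by rewrite mulrC -ler_pdivlMr// mulrAC ge_min lexx orbT.
have [T1 T10 HT1] := zu_energy_attractive k3 k4 k10 k20 Df cdf f_neq0 (1 + B) d0.
have [T2 T20 HT2] := expR_decay l0 (normr_ge0 B) (divr_gt0 (divr_gt0 e0 c0) (ltr0Sn _ 2)).
exists (T1 + T2) => t0 z psi u r sol NM t tt.
have [|a /andP[ta aT] Va] := HT1 _ _ _ _ _ sol.
  move=> s ss; have := HB _ _ _ _ _ sol NM s ss; rewrite /sqnorm4.
  have := norm_le_1Dsqr (z s); have := norm_le_1Dsqr (psi s).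
  have := norm_le_1Dsqr (u s); have := norm_le_1Dsqr (r s).
  have := sqr_ge0 (z s); have := sqr_ge0 (psi s); have := sqr_ge0 (u s); have := sqr_ge0 (r s).
  by move=> *; split; lra.
have at_ : a + T2 <= t by lra.
apply: le_trans (est _ _ _ _ _ _ _ om sol ta _ _) _.
- lra.
- by move=> y yV; apply: Hd; apply: le_trans yV (le_trans Va _); rewrite ge_min lexx.
have NB := le_trans (HB _ _ _ _ _ sol NM a ta) (ler_norm B).
have := HT2 (t - a); rewrite lerBrDl => /(_ at_).
have := ler_wpM2l (expR_ge0 (- (l * (t - a)))) NB.
move: (expR _ * sqnorm4 _ _ _ _) (expR _ * `|B|) => x y xy ye.
have := ler_wpM2l (ltW c0) (le_trans xy ye).
have -> : c * (e / c / 3) = e / 3 by field; rewrite gt_eqF.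
have := ler_wpM2l (ltW c0) Va.
lra.
Qed.

End UniformEstimates.

(** * Existence of global solutions *)

Section Saturation.
Variables (R : realType) (A : R).
Hypothesis A0 : 0 <= A.

Definition sat (y : R) : R := Num.max (- A) (Num.min A y).

Lemma sat_id (y : R) : `|y| <= A -> sat y = y.
Proof. by rewrite ler_norml => /andP[Ay yA]; rewrite /sat min_r// max_r. Qed.

Lemma sat_cases (y : R) : [\/ [/\ y <= - A & sat y = - A], [/\ - A <= y, y <= A & sat y = y] |
  [/\ A <= y & sat y = A]].
Proof.
rewrite /sat; have [yA|yA] := leP A y.
  by apply: Or33; rewrite max_r ?(ge0_cp A0).
have [Ay|Ay] := leP y (- A); first by apply: Or31.
by apply: Or32; rewrite !ltW.
Qed.

Let norm_le (x y : R) : - y <= x -> x <= y -> `|x| <= y.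
Proof. by move=> yx xy; rewrite ler_norml yx. Qed.

Lemma norm_sat_le (y : R) : `|sat y| <= A.
Proof.
have A0' := A0; apply: norm_le; case: (sat_cases y) => [[? ->]|[? ? ->]|[? ->]]; lra.
Qed.

Lemma sat_lipschitz (x y : R) : `|sat x - sat y| <= `|x - y|.
Proof.
have := ler_norm (x - y); have := ler_norm (y - x); rewrite distrC.
move: `|y - x| => d h1 h2.
have A0' := A0; apply: norm_le; case: (sat_cases x) => [[? ->]|[? ? ->]|[? ->]];
  case: (sat_cases y) => [[? ->]|[? ? ->]|[? ->]]; lra.
Qed.

Lemma sat_mul_ge0 (y : R) : 0 <= sat y * y.
Proof.
by have A0' := A0; case: (sat_cases y) => [[? ->]|[? ? ->]|[? ->]]; nra.
Qed.

Lemma continuous_sat : continuous sat.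
Proof.
move=> x; apply/cvgrPdist_le => e e0; near=> y.
by rewrite (le_trans (sat_lipschitz _ _)).
Unshelve. all: by end_near. Qed.

(* the primitive of [2 * sat]; it equals [y ^+ 2] where [sat] is the identity *)
Definition sat_energy (y : R) : R := sat y * (2 * y - sat y).

Lemma sat_energy_le (y : R) : sat_energy y <= y ^+ 2.
Proof.
rewrite -subr_ge0 /sat_energy [leRHS](_ : _ = (y - sat y) ^+ 2) ?sqr_ge0//; ring.
Qed.

Lemma sat_energy_ge0 (y : R) : 0 <= sat_energy y.
Proof. have A0' := A0; rewrite /sat_energy; case: (sat_cases y) => [[? ->]|[? ? ->]|[? ->]]; nra. Qed.

(** Outside [[- A, A]] the energy grows linearly from the value [A ^+ 2], so a bound on it still
    confines the unsaturated argument. *)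
Lemma sat_energy_lt (y : R) : sat_energy y < A ^+ 2 -> `|y| <= A.
Proof.
have A0' := A0; rewrite /sat_energy => yA; apply: norm_le; rewrite leNgt; apply/negP => yA';
  by move: yA; case: (sat_cases y) => [[? ->]|[? ? ->]|[? ->]]; nra.
Qed.

(** A quadratic error bound can be checked by cases on the pieces of a piecewise function, and thus
    also covers its junction points. *)
Lemma is_derive_sqr_error (g : R -> R) (y l : R) :
  (forall h, `|g (h + y) - g y - l * h| <= h ^+ 2) -> is_derive y 1 g l.
Proof.
move=> gl.
suff cl : (fun h => h^-1 *: ((g \o shift y) (h *: 1) - g y)) @ 0^' --> l.
  split; first by apply/cvg_ex; exists l.
  exact: (cvg_lim (@Rhausdorff R) cl).
apply/cvgrPdist_le => e e0; near=> h.
have h0 : h != 0 by near: h; exact: nbhs_dnbhs_neq.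
apply: (@le_trans _ _ `|h|); last first.
  near: h; have /cvgrPdist_le/(_ e e0) := @cvg_id _ (nbhs (0 : R)).
  by move=> /(nbhs_dnbhs); apply: filterS => h; rewrite sub0r normrN.
rewrite /= /GRing.scale/= mulr1 distrC.
rewrite [X in `|X|](_ : _ = h^-1 * (g (h + y) - g y - l * h)); last by field.
rewrite normrM normfV ler_pdivrMl ?normr_gt0//.
by apply: le_trans (gl h) _; rewrite -(real_normK (num_real h)).
Unshelve. all: by end_near. Qed.

Lemma is_derive_sat_energy (y : R) : is_derive y 1 sat_energy (2 * sat y).
Proof.
apply: is_derive_sqr_error => h; rewrite /sat_energy.
have A0' := A0; apply: norm_le; case: (sat_cases (h + y)) => [[? ->]|[? ? ->]|[? ->]];
  case: (sat_cases y) => [[? ->]|[? ? ->]|[? ->]]; nra.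
Qed.

End Saturation.

(** * The saturated loop, global existence and admissibility *)

Section Existence.
Variables (R : realType) (k1 k2 k3 k4 : R) (f df : R -> R).
Hypotheses (k10 : 0 < k1) (k20 : 0 < k2) (k30 : 0 < k3) (k40 : 0 < k4).
Hypothesis Df : forall y : R, is_derive y 1 f (df y).
Hypothesis cdf : continuous df.
Hypothesis f0 : f 0 = 0.

Let cf : continuous f.
Proof. by move=> y; apply: differentiable_continuous; apply/derivable1_diffP; case: (Df y). Qed.

Lemma closed_loopE t (x : 'rV[R]_4) :
  [/\ closed_loop k1 k2 k3 k4 f t x 0 0 = - (x 0 2 * x 0 3),
      closed_loop k1 k2 k3 k4 f t x 0 1 = x 0 3,
      closed_loop k1 k2 k3 k4 f t x 0 2 = k1 * x 0 0 * x 0 3 - k2 * x 0 2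
    & closed_loop k1 k2 k3 k4 f t x 0 3 =
        - k3 * x 0 1 - k4 * x 0 3 + f (x 0 0) * cos t].
Proof. by split; rewrite !mxE /= ?mxE. Qed.

(* Globally Lipschitz, agrees with [closed_loop] on the box of radius A, and keeps
   the energy estimates: V is replaced by [k1 * sat_energy z + sat_energy u], while
   the oscillator (psi, r) is left unsaturated. *)
Definition sat_loop (A t : R) (x : 'rV[R]_4) : 'rV[R]_4 :=
  let c := sat A in
  rvec 4 [:: - (c (x 0 2) * c (x 0 3)); x 0 3;
    k1 * c (x 0 0) * c (x 0 3) - k2 * x 0 2;
    - k3 * x 0 1 - k4 * x 0 3 + f (c (x 0 0)) * cos t].

Lemma sat_loopE A t (x : 'rV[R]_4) :
  [/\ sat_loop A t x 0 0 = - (sat A (x 0 2) * sat A (x 0 3)),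
      sat_loop A t x 0 1 = x 0 3,
      sat_loop A t x 0 2 = k1 * sat A (x 0 0) * sat A (x 0 3) - k2 * x 0 2
    & sat_loop A t x 0 3 =
        - k3 * x 0 1 - k4 * x 0 3 + f (sat A (x 0 0)) * cos t].
Proof. by split; rewrite !mxE. Qed.

Lemma forall_ord4 (P : 'I_4 -> Prop) : P 0 -> P 1 -> P 2 -> P 3 -> forall i, P i.
Proof.
move=> P0 P1 P2 P3 [[|[|[|[|//]]]] i4].
- by rewrite (_ : Ordinal i4 = 0)//; apply: val_inj.
- by rewrite (_ : Ordinal i4 = 1)//; apply: val_inj.
- by rewrite (_ : Ordinal i4 = 2)//; apply: val_inj.
- by rewrite (_ : Ordinal i4 = 3)//; apply: val_inj.
Qed.

Lemma sat_loop_id A t (x : 'rV[R]_4) : `|x| <= A ->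
  sat_loop A t x = closed_loop k1 k2 k3 k4 f t x.
Proof.
move=> xA; have [c0 c1 c2 c3] := closed_loopE t x; have [s0 s1 s2 s3] := sat_loopE A t x.
have xi i : sat A (x 0 i) = x 0 i by rewrite sat_id// (le_trans (normr_coord_le _ _)).
by apply/rowP; apply: forall_ord4; rewrite ?c0 ?c1 ?c2 ?c3 ?s0 ?s1 ?s2 ?s3 ?xi.
Qed.

Let f_lipschitz A : 0 <= A -> exists2 L, 0 <= L & forall x y : R,
  `|x| <= A -> `|y| <= A -> `|f x - f y| <= L * `|x - y|.
Proof.
move=> A0; have [L L0 HL] := continuous_norm_le cdf A; exists L => // x y.
wlog xy : x y / x <= y.
  move=> H xA yA; have [|/ltW yx] := leP x y; first by move/H; apply.
  by rewrite distrC [`|x - y|]distrC; apply: H.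
rewrite ler_norml => /andP[Ax xA]; rewrite ler_norml => /andP[Ay yA].
have [c + fE] := MVT_segment (f := f) xy (fun t _ => Df t) (continuous_subspaceT cf).
rewrite in_itv/= => /andP[xc cy].
have -> : f x - f y = df c * (x - y) by rewrite -opprB fE; ring.
rewrite normrM ler_wpM2r// HL// ler_norml; apply/andP; split; lra.
Qed.

Lemma sat_loop_lipschitz A : 0 <= A -> exists2 L, 0 < L & forall t v w,
  `|sat_loop A t v - sat_loop A t w| <= L * `|v - w|.
Proof.
move=> A0; have [Lf Lf0 HLf] := f_lipschitz A0.
have [p1 p2 p3 p4] := And4 k10 k20 k30 k40.
pose L := 2 * A + 1 + k1 * (2 * A) + k2 + k3 + k4 + Lf.
exists L => [|t v w]; first by rewrite /L; have := mulr_ge0 (ltW k10) A0; lra.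
have D i : `|v 0 i - w 0 i| <= `|v - w|.
  by have := normr_coord_le (v - w) i; rewrite !mxE.
have S i : `|sat A (v 0 i) - sat A (w 0 i)| <= `|v - w|.
  exact: le_trans (sat_lipschitz A0 _ _) (D i).
have M i j : `|sat A (v 0 i) * sat A (v 0 j) - sat A (w 0 i) * sat A (w 0 j)| <= 2 * A * `|v - w|.
  rewrite [X in `|X|](_ : _ = sat A (v 0 i) * (sat A (v 0 j) - sat A (w 0 j))
    + (sat A (v 0 i) - sat A (w 0 i)) * sat A (w 0 j)); last by ring.
  apply: le_trans (ler_normD _ _) _; rewrite !normrM mulrDl mulrDl mul1r; apply: lerD.
    by apply: ler_pM => //; exact: norm_sat_le.
  by rewrite mulrC; apply: ler_pM => //; exact: norm_sat_le.
have F : `|f (sat A (v 0 0)) * cos t - f (sat A (w 0 0)) * cos t| <= Lf * `|v - w|.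
  rewrite -mulrBl normrM -[leRHS]mulr1; apply: ler_pM => //; last by rewrite ler_norml cos_geN1 cos_le1.
  apply: le_trans (HLf _ _ _ _) _; [exact: norm_sat_le|exact: norm_sat_le|].
  by rewrite ler_wpM2l.
have d0 := normr_ge0 (v - w); move: (`|v - w|) d0 D M F {S} => d d0 D M F.
have kd (k : R) : 0 <= k -> 0 <= k * d by move=> k0; exact: mulr_ge0.
have [h1 h2 h3 h4 h5] := And5 (kd _ (ltW k20)) (kd _ (ltW k30)) (kd _ (ltW k40)) (kd _ Lf0) (kd _ A0).
have h6 := mulr_ge0 (ltW k10) h5.
have [s0 s1 s2 s3] := sat_loopE A t v; have [s0' s1' s2' s3'] := sat_loopE A t w.
have kM (k x c : R) : 0 <= k -> `|x| <= c -> `|k * x| <= k * c.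
  by move=> kk0 xc; rewrite normrM ger0_norm// ler_wpM2l.
apply: normr_row_le; first by rewrite mulr_ge0// /L; have := mulr_ge0 (ltW k10) A0; lra.
apply: forall_ord4; rewrite mxE [X in _ + X]mxE ?s0 ?s1 ?s2 ?s3 ?s0' ?s1' ?s2' ?s3'.
- by rewrite -opprD normrN; apply: le_trans (M _ _) _; rewrite /L; lra.
- by apply: le_trans (D _) _; rewrite /L; lra.
- rewrite [X in `|X|](_ : _ = k1 * (sat A (v 0 0) * sat A (v 0 3) - sat A (w 0 0) * sat A (w 0 3))
    - k2 * (v 0 2 - w 0 2)); last by ring.
  apply: le_trans (ler_normB _ _) _.
  apply: le_trans (lerD (kM _ _ _ (ltW k10) (M _ _)) (kM _ _ _ (ltW k20) (D _))) _.
  by rewrite /L; lra.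
- rewrite [X in `|X|](_ : _ = (f (sat A (v 0 0)) * cos t - f (sat A (w 0 0)) * cos t)
    - (k3 * (v 0 1 - w 0 1) + k4 * (v 0 3 - w 0 3))); last by ring.
  apply: le_trans (ler_normB _ _) _; apply: le_trans (lerD F (ler_normD _ _)) _.
  apply: le_trans (lerD (lexx _) (lerD (kM _ _ _ (ltW k30) (D _)) (kM _ _ _ (ltW k40) (D _)))) _.
  by rewrite /L; lra.
Qed.

Lemma continuous_sat_loop A (x : R -> 'rV[R]_4) : 0 <= A -> continuous x ->
  continuous (fun t => sat_loop A t (x t)).
Proof.
move=> A0 cx; apply: continuous_rowP => i.
have cxi j : continuous (fun t => x t 0 j).
  by move=> t; apply: (@continuous_comp _ _ _ x (fun v : 'rV_4 => v 0 j));
    [exact: cx|exact: coord_continuous].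
have csx j : continuous (fun t => sat A (x t 0 j)).
  by move=> t; apply: (@continuous_comp _ _ _ (fun t => x t 0 j) (sat A));
    [exact: cxi|exact: continuous_sat].
have cfx : continuous (fun t => f (sat A (x t 0 0))).
  by move=> t; apply: (@continuous_comp _ _ _ (fun t => sat A (x t 0 0)) f);
    [exact: csx|exact: cf].
move: i; apply: forall_ord4.
- rewrite [X in continuous X](_ : _ = fun t => - (sat A (x t 0 2) * sat A (x t 0 3))).
    by move=> t; apply: cvgN; apply: cvgM; exact: csx.
  by apply/funext => t; have [] := sat_loopE A t (x t).
- rewrite [X in continuous X](_ : _ = fun t => x t 0 3); first exact: cxi.
  by apply/funext => t; have [] := sat_loopE A t (x t).
- rewrite [X in continuous X](_ : _ = fun t => k1 * sat A (x t 0 0) * sat A (x t 0 3) - k2 * x t 0 2).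
    move=> t; apply: cvgB; apply: cvgM; [apply: cvgM; [exact: cvg_cst|exact: csx]|exact: csx|exact: cvg_cst|exact: cxi].
  by apply/funext => t; have [] := sat_loopE A t (x t).
- rewrite [X in continuous X](_ : _ = fun t => - k3 * x t 0 1 - k4 * x t 0 3 + f (sat A (x t 0 0)) * cos t).
    move=> t; apply: cvgD; last by apply: cvgM; [exact: cfx|exact: continuous_cos].
    by apply: cvgB; apply: cvgM; [exact: cvg_cst|exact: cxi|exact: cvg_cst|exact: cxi].
  by apply/funext => t; have [] := sat_loopE A t (x t).
Qed.

(** The saturated loop has a global solution, and energy bounds depending only on [x0] keep it in
    the box of radius [A], where the saturation is inactive. *)
Lemma exists_solution t0 (x0 : 'rV[R]_4) : exists x : R -> 'rV[R]_4, x t0 = x0 /\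
  forall i, C1_after t0 (fun t => x t 0 i) (fun t => closed_loop k1 k2 k3 k4 f t (x t) 0 i).
Proof.
have [l [kap [l0 kap0 decay]]] := osc_energy_decay k30 k40.
pose V0 := zu_energy k1 (x0 0 0) (x0 0 2).
have V00 : 0 <= V0 by rewrite addr_ge0 ?sqr_ge0// mulr_ge0 ?sqr_ge0// ltW.
have [om om0 Hom] := continuous_norm_le cf (1 + V0 / k1).
pose W0 := osc_energy k3 k4 (x0 0 1) (x0 0 3).
have W00 : 0 <= W0 by exact: osc_energy_ge0.
(* The four summands will bound the squares of [z], [u], [psi] and [r], in this order. *)
pose S := V0 / k1 + V0 + (W0 + kap * om ^+ 2) / k3 + 2 * (W0 + kap * om ^+ 2).
have Vk0 : 0 <= V0 / k1 by rewrite divr_ge0// ltW.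
have WK0 : 0 <= W0 + kap * om ^+ 2 by rewrite addr_ge0// mulr_ge0 ?sqr_ge0// ltW.
have Wk0 : 0 <= (W0 + kap * om ^+ 2) / k3 by rewrite divr_ge0// ltW.
(* The added 1 makes [S < A <= A ^+ 2], hence the strict inequality asked by [sat_energy_lt], and
   lets [y ^+ 2 <= S] imply [|y| <= A]. *)
pose A := 1 + S.
have A1 : 1 <= A by rewrite /A /S; lra.
have A0 : 0 <= A by lra.
have AA : A <= A ^+ 2 by rewrite expr2 ler_peMr.
have sqrA (y c : R) : y ^+ 2 <= c -> c <= S -> `|y| <= A.
  rewrite -(real_normK (num_real y)) /A => yc cS.
  by have := sqr_ge0 (`|y| - 1); have := sqr_ge0 `|y|; lra.
have [L L0 HL] := sat_loop_lipschitz A0.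
have [|t|x [xt0 Dx]] := @cauchy_lipschitz R 4 (sat_loop A) L (L * `|x0|) t0 x0 L0 HL.
- move=> t; have := HL t x0 0; rewrite subr0 (_ : sat_loop A t 0 = 0) ?subr0//.
  rewrite sat_loop_id ?normr0//; apply/rowP.
  have [c0 c1 c2 c3] := closed_loopE t (0 : 'rV[R]_4).
  by apply: forall_ord4; rewrite ?c0 ?c1 ?c2 ?c3 !mxE ?f0; ring.
- exact: continuous_sat_loop.
have Dz : C1_after t0 (fun t => x t 0 0) (fun t => - (sat A (x t 0 2) * sat A (x t 0 3))).
  by apply: C1_after_eq (Dx 0) _ => t _; have [] := sat_loopE A t (x t).
have Dpsi : C1_after t0 (fun t => x t 0 1) (fun t => x t 0 3).
  by apply: C1_after_eq (Dx 1) _ => t _; have [] := sat_loopE A t (x t).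
have Du : C1_after t0 (fun t => x t 0 2)
    (fun t => k1 * sat A (x t 0 0) * sat A (x t 0 3) - k2 * x t 0 2).
  by apply: C1_after_eq (Dx 2) _ => t _; have [] := sat_loopE A t (x t).
have Dr : C1_after t0 (fun t => x t 0 3)
    (fun t => - k3 * x t 0 1 - k4 * x t 0 3 + f (sat A (x t 0 0)) * cos t).
  by apply: C1_after_eq (Dx 3) _ => t _; have [] := sat_loopE A t (x t).
have DPhi j dx : C1_after t0 (fun t => x t 0 j) dx ->
    C1_after t0 (fun t => sat_energy A (x t 0 j)) (fun t => 2 * sat A (x t 0 j) * dx t).
  exact: (C1_after_comp (is_derive_sat_energy A0)).
(* The coupling terms cancel as for [zu_energy], because the saturated factors are half the
   derivatives of the saturated energies. *)
have Phi_le t : t0 <= t -> k1 * sat_energy A (x t 0 0) + sat_energy A (x t 0 2) <= V0.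
  move=> tt; have := DPhi _ _ Dz; have := DPhi _ _ Du => DPu DPz.
  have := C1_after_nincr (C1_afterD (C1_afterM (C1_after_cst t0 k1) DPz) DPu) (lexx t0) tt.
  rewrite xt0 => H; apply: le_trans (H _) _ => [s _|].
    rewrite [leLHS](_ : _ = - (2 * k2 * (sat A (x s 0 2) * x s 0 2))); last by ring.
    by rewrite oppr_le0 mulr_ge0// ?sat_mul_ge0// mulr_ge0// ltW.
  by apply: lerD; [rewrite ler_pM2l//|]; exact: sat_energy_le.
have z_A t : t0 <= t -> `|x t 0 0| <= A.
  move=> tt; apply: (sat_energy_lt A0); apply: lt_le_trans AA.
  apply: (@le_lt_trans _ _ (V0 / k1)); last by rewrite /A /S; lra.
  rewrite ler_pdivlMr// mulrC; apply: le_trans (Phi_le _ tt).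
  by rewrite lerDl; exact: sat_energy_ge0.
have u_A t : t0 <= t -> `|x t 0 2| <= A.
  move=> tt; apply: (sat_energy_lt A0); apply: lt_le_trans AA.
  apply: (@le_lt_trans _ _ V0); last by rewrite /A /S; lra.
  apply: le_trans (Phi_le _ tt).
  by rewrite lerDr mulr_ge0 ?sat_energy_ge0// ltW.
(* Now that [z] is known to be unsaturated, its energy is [z ^+ 2]; this bounds the forcing before
   anything is known about [psi] and [r]. *)
have f_om t : t0 < t -> `|f (sat A (x t 0 0)) * cos t| <= om.
  move=> tt; rewrite normrM -[leRHS]mulr1; apply: ler_pM => //; last by rewrite ler_norml cos_geN1 cos_le1.
  rewrite (sat_id (z_A _ (ltW tt))); apply: Hom.
  have : x t 0 0 ^+ 2 <= V0 / k1.
    rewrite ler_pdivlMr// mulrC; apply: le_trans (Phi_le _ (ltW tt)).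
    rewrite /sat_energy (sat_id (z_A _ (ltW tt))) (_ : 2 * _ - _ = x t 0 0); last by ring.
    by rewrite lerDl; exact: sat_energy_ge0.
  rewrite -(real_normK (num_real (x t 0 0))) => h.
  by have := sqr_ge0 (`|x t 0 0| - 1); have := sqr_ge0 `|x t 0 0|; lra.
have W_le t : t0 <= t -> osc_energy k3 k4 (x t 0 1) (x t 0 3) <= W0 + kap * om ^+ 2.
  move=> tt; apply: le_trans (decay _ _ _ _ _ _ _ Dpsi Dr (lexx t0) tt f_om) _.
  by rewrite lerD2r xt0 ler_piMl// -expR0 ler_expR oppr_le0 mulr_ge0 ?subr_ge0// ltW.
have psir_A t : t0 <= t -> `|x t 0 1| <= A /\ `|x t 0 3| <= A.
  move=> tt; have Wt := W_le t tt.
  have [h1 h2] := osc_energy_ge k4 k30 (x t 0 1) (x t 0 3); split.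
    apply: (sqrA _ ((W0 + kap * om ^+ 2) / k3)); last by rewrite /S; lra.
    by rewrite ler_pdivlMr// mulrC (le_trans h1).
  by apply: (sqrA _ (2 * (W0 + kap * om ^+ 2))); [lra|rewrite /S; lra].
exists x; split=> // i; apply: C1_after_eq (Dx i) _ => t tt; rewrite sat_loop_id//.
apply: normr_row_le => //; have [h1 h3] := psir_A _ (ltW tt).
by apply: forall_ord4 => //; [exact: z_A (ltW tt)|exact: u_A (ltW tt)].
Qed.

(** Along the constant path [v], saturation at level [|v|] is inactive. *)
Lemma closed_loop_continuous_time (v : 'rV[R]_4) :
  continuous (fun t => closed_loop k1 k2 k3 k4 f t v).
Proof.
have := @continuous_sat_loop `|v| (fun=> v) (normr_ge0 v) (@cst_continuous _ _ v).
by under eq_fun do rewrite sat_loop_id//.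
Qed.

Lemma closed_loop_admissible : admissible_system (closed_loop k1 k2 k3 k4 f).
Proof.
split.
- move=> t; apply/rowP; have [c0 c1 c2 c3] := closed_loopE t (0 : 'rV[R]_4).
  by apply: forall_ord4; rewrite ?c0 ?c1 ?c2 ?c3 !mxE ?f0; ring.
- move=> v a b; exists [::] => t _; have ct := @closed_loop_continuous_time v t.
  split=> //; apply/cvg_ex; exists (closed_loop k1 k2 k3 k4 f t v).
    exact: cvg_at_left_filter.
  exact: cvg_at_right_filter.
(* On the unit ball around [x0] the closed loop coincides with the loop saturated at this level,
   which is globally Lipschitz uniformly in time. *)
- move=> a b x0; pose A := `|x0| + 1; exists [set x | `|x| <= A].
    apply/nbhs_ballP; exists 1 => //= x; rewrite -ball_normE/= => xx0.
    rewrite -[x](subrKC x0) (le_trans (ler_normD _ _))// lerD2l distrC ltW//.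
  have A0 : 0 <= A by rewrite addr_ge0.
  have [L L0 HL] := sat_loop_lipschitz A0.
  exists L => t _ [v w] [/= vA wA].
  by rewrite -!(@sat_loop_id A)//; exact: HL.
Qed.

End Existence.

(** * From trajectories to the class kl estimate *)

Lemma enorm4E (R : realType) (x : 'rV[R]_4) :
  enorm x = Num.sqrt (sqnorm4 (x 0 0) (x 0 1) (x 0 2) (x 0 3)).
Proof.
rewrite /enorm /sqnorm4 !big_ord_recl big_ord0 addr0 !addrA.
by congr (Num.sqrt (_ + _ ^+ 2 + _ ^+ 2 + _ ^+ 2)); congr (x _ _); apply: val_inj.
Qed.

Section Trajectories.
Variables (R : realType) (k1 k2 k3 k4 : R) (f df : R -> R).
Hypotheses (k10 : 0 < k1) (k20 : 0 < k2) (k30 : 0 < k3) (k40 : 0 < k4).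
Hypothesis Df : forall y : R, is_derive y 1 f (df y).
Hypothesis cdf : continuous df.
Hypothesis f0 : forall y, f y = 0 <-> y = 0.
Notation F := (closed_loop k1 k2 k3 k4 f).

Let f00 : f 0 = 0. Proof. exact: (f0 0).2. Qed.

(** The closed loop is continuous in time, so the equation holds at every [t > t0]; freezing the
    trajectory before [t0] makes its coordinates continuous on all of R. *)
Lemma trajectory_solution t0 x0 x : trajectory F t0 x0 x ->
  solution k1 k2 k3 k4 f t0 (fun t => x (Num.max t t0) 0 0)
    (fun t => x (Num.max t t0) 0 1) (fun t => x (Num.max t t0) 0 2)
    (fun t => x (Num.max t t0) 0 3).
Proof.
move=> [_ cx Dx].
have Dxi i : C1_after t0 (fun t => x (Num.max t t0) 0 i) (fun t => F t (x t) 0 i).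
  apply: (C1_after_clamp_past (g := fun t => x t 0 i)) => [|t tt].
    by apply: (@within_continuous_comp _ _ _ _ x (fun v : 'rV_4 => v 0 i)) => // v _;
      exact: coord_continuous.
  apply: (is_derive_rowP x t _).1 => //.
  by apply: Dx => //; exact: (closed_loop_continuous_time Df).
by split; [move: (Dxi 0)|move: (Dxi 1)|move: (Dxi 2)|move: (Dxi 3)] => /C1_after_eq;
  apply=> t tt; rewrite max_l ?(ltW tt)//;
  have [c0 c1 c2 c3] := closed_loopE k1 k2 k3 k4 f t (x t); rewrite ?c0 ?c1 ?c2 ?c3.
Qed.

Lemma solution_trajectory t0 (x : R -> 'rV[R]_4) :
  (forall i, C1_after t0 (fun t => x t 0 i) (fun t => F t (x t) 0 i)) ->
  trajectory F t0 (x t0) x.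
Proof.
move=> Dx; split=> //.
  by apply: continuous_subspaceT; apply: continuous_rowP => i; case: (Dx i).
by move=> t tt _; apply/is_derive_rowP => i; have [_] := Dx i; exact.
Qed.

Lemma closed_loop_GUAS : GUAS F.
Proof.
split; first exact: (closed_loop_admissible k10 k20 k30 k40 Df cdf f00).
(* Initial times and states are quantified inside [D], so the majorant obtained from it is uniform
   in both. *)
pose D (rho sigma v : R) := exists t0 x0 x t, [/\ trajectory F t0 x0 x, t0 <= t,
  rho = enorm x0, sigma = t - t0 & v = enorm (x t)].
have sqrt_le (a c : R) : 0 <= a -> 0 <= c -> (Num.sqrt a <= c) = (a <= c ^+ 2).
  by move=> a0 c0; rewrite -ler_sqr ?nnegrE ?sqrtr_ge0// sqr_sqrtr.
have D_ge0 rho sigma v : D rho sigma v -> 0 <= rho /\ 0 <= v.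
  by move=> [t0 [x0 [x [t [_ _ -> _ ->]]]]]; rewrite !sqrtr_ge0.
have DE rho sigma v : D rho sigma v -> exists t0 (z psi u r : R -> R) t,
    [/\ solution k1 k2 k3 k4 f t0 z psi u r, t0 <= t, sigma = t - t0,
     rho = Num.sqrt (sqnorm4 (z t0) (psi t0) (u t0) (r t0)) &
     v = Num.sqrt (sqnorm4 (z t) (psi t) (u t) (r t))].
  move=> [t0 [x0 [x [t [xtraj tt -> -> ->]]]]].
  have := trajectory_solution xtraj; have [x0E _ _] := xtraj => sol.
  do 5!eexists; exists t; split; [exact: sol|exact: tt|by []| |].
    by rewrite /= maxxx x0E enorm4E.
  by rewrite /= max_l// enorm4E.
have S0 (z psi u r : R) : 0 <= sqnorm4 z psi u r by rewrite /sqnorm4 !addr_ge0// sqr_ge0.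
have [M|e e0|M e e0|chi [chi_kl Hchi]] := @kl_majorant R D D_ge0.
- have [B HB] := solution_bounded k10 k20 k30 k40 Df (M ^+ 2).
  exists (Num.sqrt B) => rho sigma v /DE[t0 [z [psi [u [r [t [sol tt _ -> ->]]]]]]] NM.
  have M0 : 0 <= M by rewrite (le_trans _ NM)// sqrtr_ge0.
  by apply: ler_wsqrtr; apply: HB sol _ _ tt; rewrite -sqrt_le.
- have [d d0 Hd] := solution_stable k10 k20 k30 k40 Df f0 (exprn_gt0 2 e0).
  exists (Num.sqrt d); first by rewrite sqrtr_gt0.
  move=> rho sigma v /DE[t0 [z [psi [u [r [t [sol tt _ -> ->]]]]]]] Nd.
  rewrite sqrt_le ?(ltW e0)//; apply: Hd sol _ _ tt.
  by move: Nd; rewrite ler_psqrt ?nnegrE// ltW.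
- have [T HT] := solution_attractive k10 k20 k30 k40 Df cdf f0 (M ^+ 2) (exprn_gt0 2 e0).
  exists T => rho sigma v /DE[t0 [z [psi [u [r [t [sol tt -> -> ->]]]]]]] NM Tt.
  have M0 : 0 <= M by rewrite (le_trans _ NM)// sqrtr_ge0.
  rewrite sqrt_le ?(ltW e0)//; apply: (HT _ _ _ _ _ sol).
    by rewrite -sqrt_le.
  by rewrite -lerBrDl.
exists chi; split=> // t0 x0; split.
  have [x [<- Dx]] := exists_solution k10 k20 k30 k40 Df cdf f00 t0 x0.
  by exists x; exact: solution_trajectory.
by move=> x xtraj t tt; apply: Hchi; exists t0, x0, x, t.
Qed.

End Trajectories.

Theorem theorem1 (R : realType) (k1 k2 k3 k4 : R) (f : R -> R)
    (hk1 : 0 < k1) (hk2 : 0 < k2) (hk3 : 0 < k3) (hk4 : 0 < k4)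
    (hf : smooth f) (hf0 : forall z : R, f z = 0 <-> z = 0) :
  GUAS (closed_loop k1 k2 k3 k4 f).
Proof.
have Df (y : R) : is_derive y 1 f (derive1 f y).
  by rewrite derive1E; apply/derivableP; exact: (hf 0).
apply: (closed_loop_GUAS hk1 hk2 hk3 hk4 Df _ hf0) => y.
by apply: differentiable_continuous; apply/derivable1_diffP; exact: (hf 1 y).
Qed.
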